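(* Let $(\mathcal M,g)$ be a Lorentzian conformally recurrent manifold of dimension $n\ge 5$ with null recurrence vector $\alpha_i$, $\alpha^2=\alpha^k\alpha_k=0$. Then the Weyl tensor is algebraically special, at least of type $\mathrm{II}_d$ in the Bel–Debever–Ortaggio classification.
   Context: Manifolds are smooth, connected, Hausdorff; Lorentzian means that the metric $g$ has one negative and $n-1$ positive eigenvalues (signature $n-2$); $\nabla$ is the Levi-Civita connection. Let $R_{jkl}{}^m$ be the Riemann tensor ($[\nabla_j,\nabla_k]v_l=R_{jkl}{}^m v_m$), $R_{kl}=-R_{mkl}{}^m$ the Ricci tensor, $R=g^{ij}R_{ij}$. The Weyl tensor is $$C_{jkl}{}^m=R_{jkl}{}^m+\tfrac{1}{n-2}(\delta_j{}^mR_{kl}-\delta_k{}^mR_{jl}+R_j{}^mg_{kl}-R_k{}^mg_{jl})-R\,\frac{\delta_j{}^mg_{kl}-\delta_k{}^mg_{jl}}{(n-1)(n-2)}.$$ $(\mathcal M,g)$ is conformally recurrent if $\nabla_iC_{jklm}=\alpha_iC_{jklm}$ for a non-zero covector field $\alpha_i$, called the recurrence vector. A null vector is understood to be non-zero. Type $\mathrm{II}_d$: at a point, the Weyl tensor is at least of type $\mathrm{II}_d$ if there is a null vector $\ell$ which, completed to a frame $(\ell,\nu,m_{(2)},\dots,m_{(n-1)})$ with $\ell$ and $\nu$ null, $\ell\cdot\nu=1$, and $m_{(a)}$ orthonormal space-like vectors orthogonal to $\ell$ and $\nu$, satisfies, for all $a,b,c\in\{2,\dots,n-1\}$: (1) $C(\ell,m_{(a)},\ell,m_{(b)})=0$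 (boost weight $+2$ components vanish); (2) $C(\ell,\nu,\ell,m_{(a)})=0$ and $C(\ell,m_{(a)},m_{(b)},m_{(c)})=0$ (boost weight $+1$ components vanish); (3) $C(\ell,\nu,m_{(a)},m_{(b)})=0$. Conditions (1)–(2) say that the type is II or more special; (3) is the additional condition defining the subtype $d$. ''At least'' means that the type may be more special. *)

(* Defs.v *)
From HB Require Import structures.
From mathcomp Require Import all_boot all_order all_algebra.
From mathcomp Require Import all_classical all_reals all_analysis.

Set Implicit Arguments.
Unset Strict Implicit.
Unset Printing Implicit Defensive.

Import Order.TTheory GRing.Theory Num.Theory.
Import numFieldNormedType.Exports.

Local Open Scope classical_set_scope.
Local Open Scope ring_scope.

(* Manifolds and tensor fields are described by atlases and by components in
   charts.  Component functions are total functions on R^n; only their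
   restrictions to the (open) image of the chart carry meaning. *)

Section Smoothness.
Variables (R : realType) (n : nat).

Definition pd (i : 'I_n) (f : 'rV[R]_n -> R) : 'rV[R]_n -> R :=
  fun x => 'D_(delta_mx 0 i) f x.

Fixpoint Ck (k : nat) (U : set 'rV[R]_n) (f : 'rV[R]_n -> R) : Prop :=
  (forall x, U x -> {for x, continuous f}) /\
  if k is k'.+1 then
    forall i : 'I_n,
      (forall x, U x -> derivable f x (delta_mx 0 i)) /\ Ck k' U (pd i f)
  else True.

(* To be used with U open. *)
Definition smooth_on (U : set 'rV[R]_n) (f : 'rV[R]_n -> R) : Prop :=
  forall k, Ck k U f.

End Smoothness.

Record smooth_manifold (R : realType) (n : nat) := SmoothManifold {
  mpoint : topologicalType;
  mchart : Type;
  mdom : mchart -> set mpoint;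
  mcoord : mchart -> mpoint -> 'rV[R]_n;
  mparam : mchart -> 'rV[R]_n -> mpoint;
  mpoint_hausdorff : hausdorff_space mpoint;
  mpoint_connected : connected [set: mpoint];
  mdom_open : forall c, open (mdom c);
  mdom_cover : forall p, exists c, mdom c p;
  mcoord_open : forall c, open (mcoord c @` mdom c);
  mcoordK : forall c p, mdom c p -> mparam c (mcoord c p) = p;
  mcoord_continuous : forall c p, mdom c p -> {for p, continuous (mcoord c)};
  mparam_continuous : forall c x, (mcoord c @` mdom c) x ->
    {for x, continuous (mparam c)};
  transition_smooth : forall c d (k : 'I_n),
    smooth_on (mcoord c @` (mdom c `&` mdom d))
      (fun x => mcoord d (mparam c x) 0 k)
}.

Section Fields.
Variables (R : realType) (n : nat) (M : smooth_manifold R n).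

(* The Jacobian d y^k / d x^i at p of the coordinates y of the chart d with
   respect to the coordinates x of the chart c. *)
Definition jac (c d : mchart M) (p : mpoint M) (i k : 'I_n) : R :=
  pd i (fun x => mcoord d (mparam c x) 0 k) (mcoord c p).

Record covector_field := CovectorField {
  cov :> mchart M -> 'I_n -> 'rV[R]_n -> R;
  cov_smooth : forall c i, smooth_on (mcoord c @` mdom c) (cov c i);
  cov_tensorial : forall c d p, mdom c p -> mdom d p -> forall i,
    cov c i (mcoord c p) = \sum_k jac c d p i k * cov d k (mcoord d p)
}.

(* The numbers of negative and positive eigenvalues are counted with
   multiplicity. *)
Definition lorentzian_mx (G : 'M[R]_n) : Prop :=
  G^T = G /\
  exists s : seq R,
    [/\ char_poly G = \prod_(a <- s) ('X - a%:P),
        count (fun a => a < 0) s = 1%N &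
        count (fun a => 0 < a) s = n.-1].

Record lorentzian_metric := LorentzianMetric {
  met :> mchart M -> 'rV[R]_n -> 'M[R]_n;
  met_smooth : forall c i j,
    smooth_on (mcoord c @` mdom c) (fun x => met c x i j);
  met_tensorial : forall c d p, mdom c p -> mdom d p -> forall i j,
    met c (mcoord c p) i j =
    \sum_k \sum_l jac c d p i k * jac c d p j l * met d (mcoord d p) k l;
  met_lorentzian : forall c p, mdom c p -> lorentzian_mx (met c (mcoord c p))
}.

End Fields.

(* Tensor calculus in one chart, for the metric with component matrix g.  The
   indices of a field come first, in the order of the index notation, then the
   coordinates of the point. *)
Section LocalTensors.
Variables (R : realType) (n : nat) (g : 'rV[R]_n -> 'M[R]_n).

Implicit Types (i j k l m p q : 'I_n) (x : 'rV[R]_n).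

Definition ginv i j x : R := invmx (g x) i j.

(* Gamma^p_{ij} of the Levi-Civita connection *)
Definition christoffel p i j x : R :=
  2%:R^-1 * \sum_q ginv p q x *
    (pd i (fun y => g y q j) x + pd j (fun y => g y q i) x
     - pd q (fun y => g y i j) x).

(* nabla_i v_j *)
Definition nabla1 (v : 'I_n -> 'rV[R]_n -> R) i j x : R :=
  pd i (v j) x - \sum_p christoffel p i j x * v p x.

(* nabla_i T_{jk} *)
Definition nabla2 (T : 'I_n -> 'I_n -> 'rV[R]_n -> R) i j k x : R :=
  pd i (T j k) x
  - \sum_p christoffel p i j x * T p k x
  - \sum_p christoffel p i k x * T j p x.

(* nabla_i T_{jklm} *)
Definition nabla4 (T : 'I_n -> 'I_n -> 'I_n -> 'I_n -> 'rV[R]_n -> R)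
    i j k l m x : R :=
  pd i (T j k l m) x
  - \sum_p christoffel p i j x * T p k l m x
  - \sum_p christoffel p i k x * T j p l m x
  - \sum_p christoffel p i l x * T j k p m x
  - \sum_p christoffel p i m x * T j k l p x.

(* [nabla_j, nabla_k] v_l *)
Definition commutator (v : 'I_n -> 'rV[R]_n -> R) j k l x : R :=
  nabla2 (nabla1 v) j k l x - nabla2 (nabla1 v) k j l x.

(* R_{jkl}^m, read off from [nabla_j, nabla_k] v_l = R_{jkl}^m v_m by taking
   for v the coordinate covector field d x^m. *)
Definition riemann j k l m x : R :=
  commutator (fun q _ => (q == m)%:R) j k l x.

(* R_{kl} = - R_{mkl}^m *)
Definition ricci k l x : R := - \sum_m riemann m k l m x.

(* R_j^m *)
Definition ricci_mixed j m x : R := \sum_p ricci j p x * ginv p m x.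

Definition scalar_curvature x : R := \sum_i \sum_j ginv i j x * ricci i j x.

(* C_{jkl}^m *)
Definition weyl_mixed j k l m x : R :=
  riemann j k l m x
  + (n%:R - 2%:R)^-1 *
      ((j == m)%:R * ricci k l x - (k == m)%:R * ricci j l x
       + ricci_mixed j m x * g x k l - ricci_mixed k m x * g x j l)
  - scalar_curvature x *
      (((j == m)%:R * g x k l - (k == m)%:R * g x j l)
       / ((n%:R - 1) * (n%:R - 2%:R))).

(* C_{jklm} *)
Definition weyl j k l m x : R := \sum_p weyl_mixed j k l p x * g x p m.

End LocalTensors.

Section TypeIId.
Variables (R : realType) (n : nat).

Definition inner (G : 'M[R]_n) (u v : 'rV[R]_n) : R :=
  \sum_i \sum_j G i j * u 0 i * v 0 j.

Definition eval4 (C : 'I_n -> 'I_n -> 'I_n -> 'I_n -> R)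
    (u v w z : 'rV[R]_n) : R :=
  \sum_j \sum_k \sum_l \sum_m C j k l m * u 0 j * v 0 k * w 0 l * z 0 m.

(* A null frame (ell, nu, e_a): the n - 2 vectors e_a are indexed from 0. *)
Definition null_frame (G : 'M[R]_n) (ell nu : 'rV[R]_n)
    (e : 'I_(n - 2) -> 'rV[R]_n) : Prop :=
  [/\ ell != 0 /\ inner G ell ell = 0,
      nu != 0 /\ inner G nu nu = 0,
      inner G ell nu = 1,
      forall a, inner G ell (e a) = 0 /\ inner G nu (e a) = 0 &
      forall a b, inner G (e a) (e b) = (a == b)%:R].

(* Components of boost weight +2 and +1 *)
Definition type_II_in_frame (C : 'I_n -> 'I_n -> 'I_n -> 'I_n -> R)
    (ell nu : 'rV[R]_n) (e : 'I_(n - 2) -> 'rV[R]_n) : Prop :=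
  [/\ forall a b, eval4 C ell (e a) ell (e b) = 0,
      forall a, eval4 C ell nu ell (e a) = 0 &
      forall a b c, eval4 C ell (e a) (e b) (e c) = 0].

Definition at_least_type_IId (G : 'M[R]_n)
    (C : 'I_n -> 'I_n -> 'I_n -> 'I_n -> R) : Prop :=
  exists (ell nu : 'rV[R]_n) (e : 'I_(n - 2) -> 'rV[R]_n),
    [/\ null_frame G ell nu e,
        type_II_in_frame C ell nu e &
        forall a b, eval4 C ell nu (e a) (e b) = 0].

End TypeIId.

Section Recurrence.
Variables (R : realType) (n : nat) (M : smooth_manifold R n).
Variable g : lorentzian_metric M.

Definition nonzero_at (alpha : covector_field M) (p : mpoint M) : Prop :=
  forall c, mdom c p -> exists i, alpha c i (mcoord c p) != 0.

Definition conformally_recurrent (alpha : covector_field M) : Prop :=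
  (exists p, nonzero_at alpha p) /\
  forall c p, mdom c p -> forall i j k l m,
    nabla4 (g c) (weyl (g c)) i j k l m (mcoord c p)
    = alpha c i (mcoord c p) * weyl (g c) j k l m (mcoord c p).

(* A null vector is nonzero, so a null field vanishes nowhere. *)
Definition null_covector_field (alpha : covector_field M) : Prop :=
  forall p, nonzero_at alpha p /\
    forall c, mdom c p ->
      \sum_i \sum_j ginv (g c) i j (mcoord c p)
        * alpha c i (mcoord c p) * alpha c j (mcoord c p) = 0.

Definition weyl_at_least_type_IId (p : mpoint M) : Prop :=
  forall c, mdom c p ->
    at_least_type_IId (g c (mcoord c p))
      (fun j k l m => weyl (g c) j k l m (mcoord c p)).

End Recurrence.

(* Main.v *)
(* In C = Riem + g /\ P, with P the Schouten tensor and /\ the Kulkarni-Nomizu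
   product, the second Bianchi identity turns the cyclic sum of nabla_i C_jklm
   into - (g_im Y_jkl - g_il Y_jkm + cyclic), with Y the Cotton tensor.  For a
   recurrent Weyl tensor the left-hand side is the cyclic sum of
   alpha_i C_jklm, and tracing gives (n - 3) Y_jkl = - alpha^m C_jklm.  What
   remains is linear algebra at one point.  Take ell = alpha^#, complete it to a
   null frame (ell, nu, e_a), and evaluate the identity on three vectors i, j, k
   orthogonal to ell: the left-hand side vanishes.  On (ell, e_a, e_b) and
   (e_a, e_b, e_c) a trace over the transverse directions, combined with the
   vanishing of the traces of C, gives n - 4 times each of the components
   C(ell, e_b, nu, ell), C(ell, e_b, e_c, ell) and C(e_b, e_c, nu, ell), so they
   are zero when n >= 5. *)
Require Import Defs.
From HB Require Import structures.
From mathcomp Require Import all_boot all_order all_algebra.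
From mathcomp Require Import all_classical all_reals all_analysis.
From mathcomp Require Import spectral sesquilinear complex.
From mathcomp Require Import zify ring lra.

Set Implicit Arguments.
Unset Strict Implicit.
Unset Printing Implicit Defensive.

Import Order.TTheory GRing.Theory Num.Theory.
Import numFieldNormedType.Exports.

Local Open Scope classical_set_scope.
Local Open Scope ring_scope.

(** * Smooth functions *)

(** Three inputs to the pointwise algebra need work of their own. The curvature identities are
    derived from the coordinate formulas: with the Christoffel symbols collected in matrices
    [conn i], curvature is the commutator of the operators d_i - [conn i]. Skew-symmetry and the
    second Bianchi identity then reduce to noncommutative ring identities plus commuting partial
    derivatives. Next, [lorentzian_mx] speaks of eigenvalues of the component matrix; a unitary
    diagonalization over the complex numbers turns this into positivity on the vectors orthogonal to
    ell and nu, which is what allows the transverse vectors to be normalized. Finally, a trace of C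
    becomes a sum over the frame through the expansion of the inverse metric in
    [null_frame_complete]. The constant n - 4 arises because a sum over the n - 2 transverse
    directions produces n - 2 copies of a component, two of which are removed by Kronecker deltas or
    by the ell-nu part of the trace. *)

Section SmoothFunctions.
Variables (R : realType) (n : nat) (U : set 'rV[R]_n).
Hypothesis openU : open U.
Implicit Types (f h : 'rV[R]_n -> R) (i j : 'I_n).

(** Component functions carry meaning only on [U]; as [U] is open, equality on [U] is equality near
    each of its points, which is all that limits and derivatives see. *)
Lemma near_eq_on f h x : (forall y, U y -> f y = h y) -> U x ->
  {near x, f =1 h}.
Proof.
move=> fh Ux; have Un : nbhs x U by apply: open_nbhs_nbhs.
by near=> y; apply: fh; near: y.
Unshelve. all: by end_near. Qed.

Lemma pd_ext f h i x : (forall y, U y -> f y = h y) -> U x ->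
  pd i f x = pd i h x.
Proof.
by move=> fh Ux; apply: near_eq_derive; apply: near_eq_on.
Qed.

Lemma continuous_ext f h x : (forall y, U y -> f y = h y) -> U x ->
  {for x, continuous f} -> {for x, continuous h}.
Proof.
move=> fh Ux; rewrite /prop_for /continuous_at => cf; rewrite -(fh x Ux).
exact: (cvg_trans (near_eq_cvg (near_eq_on fh Ux)) cf).
Qed.

Lemma Ck_ext k f h : (forall y, U y -> f y = h y) -> Ck k U f -> Ck k U h.
Proof.
elim: k f h => [|k IH] f h fh /= [cf df].
  by split=> // x Ux; apply: continuous_ext (cf x Ux).
split; first by move=> x Ux; apply: continuous_ext (cf x Ux).
move=> i; have [di ki] := df i; split.
  by move=> x Ux; apply: near_eq_derivable (di x Ux); apply: near_eq_on.
by apply: IH ki => x Ux; apply: pd_ext.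
Qed.

Lemma CkW k f : Ck k.+1 U f -> Ck k U f.
Proof.
elim: k f => [|k IH] f [cf df]; split=> //.
by move=> i; have [di ki] := df i; split=> //; apply: IH.
Qed.

Lemma Ck_cst k (a : R) : Ck k U (fun=> a).
Proof.
have cc (b : R) (x : 'rV[R]_n) : {for x, continuous (fun _ : 'rV[R]_n => b)}.
  exact: cst_continuous.
elim: k a => [|k IH] a; split=> //.
move=> i; split=> [x _|]; first exact: derivable_cst.
by apply: Ck_ext (IH 0) => x _; rewrite /pd derive_cst.
Qed.

Lemma CkD k f h : Ck k U f -> Ck k U h -> Ck k U (fun x => f x + h x).
Proof.
elim: k f h => [|k IH] f h /= [cf df] [ch dh].
  by split=> // x Ux; exact: (continuousD (cf x Ux) (ch x Ux)).
split=> [x Ux|i]; first exact: (continuousD (cf x Ux) (ch x Ux)).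
have [dfi kf] := df i; have [dhi kh] := dh i; split=> [x Ux|].
  by apply: derivableD; [apply: dfi|apply: dhi].
apply: Ck_ext (IH _ _ kf kh) => x Ux.
by rewrite /pd -deriveD //; [apply: dfi|apply: dhi].
Qed.

Lemma CkM k f h : Ck k U f -> Ck k U h -> Ck k U (fun x => f x * h x).
Proof.
elim: k f h => [|k IH] f h fk hk.
  case: (fk) => cf _; case: (hk) => ch _.
  by split=> // x Ux; exact: (continuousM (cf x Ux) (ch x Ux)).
(* The product rule multiplies each undifferentiated factor by a derivative that is only of order
   [k]. *)
have fW := CkW fk; have hW := CkW hk.
case: fk => cf df; case: hk => ch dh.
split=> [x Ux|i]; first exact: (continuousM (cf x Ux) (ch x Ux)).
have [dfi kf] := df i; have [dhi kh] := dh i; split=> [x Ux|].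
  by apply: derivableM; [apply: dfi|apply: dhi].
apply: Ck_ext (CkD (IH _ _ fW kh) (IH _ _ hW kf)) => x Ux.
by rewrite /pd -(deriveM (dfi x Ux) (dhi x Ux)).
Qed.

(** The derivative of 1/f is -(1/f)^2 f', so order [k.+1] for 1/f follows from order [k] for 1/f and
    for f'. *)
Lemma CkV k f : (forall x, U x -> f x != 0) -> Ck k U f ->
  Ck k U (fun x => (f x)^-1).
Proof.
move=> f0; elim: k => [|k IH] fk.
  by case: fk => cf _; split=> // x Ux; exact: (continuousV (f0 x Ux) (cf x Ux)).
have fW := CkW fk; case: fk => cf df.
split=> [x Ux|i]; first exact: (continuousV (f0 x Ux) (cf x Ux)).
have [dfi kf] := df i; split=> [x Ux|].
  by apply: derivableV; [apply: f0|apply: dfi].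
have := CkM (CkM (Ck_cst k (-1)) (CkM (IH fW) (IH fW))) kf.
apply: Ck_ext => x Ux.
rewrite /pd (deriveV (f0 x Ux) (dfi x Ux)) /GRing.scale/=.
by rewrite -exprVn expr2 mulN1r.
Qed.

Lemma smooth_ext f h : (forall y, U y -> f y = h y) ->
  smooth_on U f -> smooth_on U h.
Proof. by move=> fh sf k; apply: Ck_ext (sf k). Qed.

Lemma smooth_cst (a : R) : smooth_on U (fun=> a).
Proof. by move=> k; apply: Ck_cst. Qed.

Lemma smoothD f h : smooth_on U f -> smooth_on U h ->
  smooth_on U (fun x => f x + h x).
Proof. by move=> sf sh k; apply: CkD. Qed.

Lemma smoothM f h : smooth_on U f -> smooth_on U h ->
  smooth_on U (fun x => f x * h x).
Proof. by move=> sf sh k; apply: CkM. Qed.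

Lemma smoothN f : smooth_on U f -> smooth_on U (fun x => - f x).
Proof.
move=> sf; apply: smooth_ext (smoothM (smooth_cst (-1)) sf) => x _.
by rewrite mulN1r.
Qed.

Lemma smoothB f h : smooth_on U f -> smooth_on U h ->
  smooth_on U (fun x => f x - h x).
Proof. by move=> sf sh; apply: smoothD => //; apply: smoothN. Qed.

Lemma smoothV f : (forall x, U x -> f x != 0) -> smooth_on U f ->
  smooth_on U (fun x => (f x)^-1).
Proof. by move=> f0 sf k; apply: CkV. Qed.

Lemma smooth_sum (I : Type) (r : seq I) (P : pred I) (F : I -> 'rV[R]_n -> R) :
  (forall a, smooth_on U (F a)) -> smooth_on U (fun x => \sum_(a <- r | P a) F a x).
Proof.
move=> sF; elim: r => [|a r IH].
  by apply: smooth_ext (smooth_cst 0) => x _; rewrite big_nil.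
have : smooth_on U (fun x => (if P a then F a x else 0)
                             + \sum_(b <- r | P b) F b x).
  by apply: smoothD => //; case: (P a) => //; apply: smooth_cst.
by apply: smooth_ext => x _; rewrite big_cons; case: (P a); rewrite ?add0r.
Qed.

Lemma smooth_prod (I : Type) (r : seq I) (P : pred I) (F : I -> 'rV[R]_n -> R) :
  (forall a, smooth_on U (F a)) ->
  smooth_on U (fun x => \prod_(a <- r | P a) F a x).
Proof.
move=> sF; elim: r => [|a r IH].
  by apply: smooth_ext (smooth_cst 1) => x _; rewrite big_nil.
have : smooth_on U (fun x => (if P a then F a x else 1)
                             * \prod_(b <- r | P b) F b x).
  by apply: smoothM => //; case: (P a) => //; apply: smooth_cst.
by apply: smooth_ext => x _; rewrite big_cons; case: (P a); rewrite ?mul1r.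
Qed.

Lemma smooth_pd f i : smooth_on U f -> smooth_on U (pd i f).
Proof. by move=> sf k; have [_ df] := sf k.+1; have [] := df i. Qed.

Lemma smooth_derivable f i x : smooth_on U f -> U x ->
  derivable f x (delta_mx 0 i).
Proof. by move=> sf Ux; have [_ df] := sf 1%N; have [d _] := df i; apply: d. Qed.

Lemma smooth_continuous f x : smooth_on U f -> U x -> {for x, continuous f}.
Proof. by move=> sf Ux; have [+ _] := sf 0%N; apply. Qed.

Lemma pd_cst (a : R) i x : pd i (fun=> a) x = 0.
Proof. exact: derive_cst. Qed.

Lemma pdD f h i x : smooth_on U f -> smooth_on U h -> U x ->
  pd i (fun y => f y + h y) x = pd i f x + pd i h x.
Proof. by move=> sf sh Ux; rewrite -deriveD//; apply: smooth_derivable. Qed.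

Lemma pdM f h i x : smooth_on U f -> smooth_on U h -> U x ->
  pd i (fun y => f y * h y) x = pd i f x * h x + f x * pd i h x.
Proof.
move=> sf sh Ux.
have df : derivable f x (delta_mx 0 i) by apply: smooth_derivable.
have dh : derivable h x (delta_mx 0 i) by apply: smooth_derivable.
by rewrite /pd [LHS](deriveM df dh) /GRing.scale/= addrC (mulrC (h x)).
Qed.

Lemma pdN f i x : smooth_on U f -> U x -> pd i (fun y => - f y) x = - pd i f x.
Proof.
by move=> sf Ux; rewrite -deriveN//; apply: smooth_derivable.
Qed.

Lemma pd_sum (I : Type) (r : seq I) (F : I -> 'rV[R]_n -> R) i x :
  (forall a, smooth_on U (F a)) -> U x ->
  pd i (fun y => \sum_(a <- r) F a y) x = \sum_(a <- r) pd i (F a) x.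
Proof.
move=> sF Ux; elim: r => [|a r IH].
  rewrite big_nil -[RHS](pd_cst 0 i x); apply: pd_ext => // y _.
  by rewrite big_nil.
rewrite big_cons -IH -(pdD _ (sF a) (smooth_sum r predT sF)) //.
by apply: pd_ext => // y _; rewrite big_cons.
Qed.

End SmoothFunctions.

(** * Symmetry of mixed partial derivatives *)

Section MixedPartials.
Variables (R : realType) (n : nat).
Implicit Types (f : 'rV[R]_n -> R) (x y v w : 'rV[R]_n).

Lemma is_derive_line f y v (c : R) : derivable f (c *: v + y) v ->
  is_derive c 1 (fun t : R => f (t *: v + y)) ('D_v f (c *: v + y)).
Proof.
have E : (fun h : R => h^-1 *: (((fun t : R => f (t *: v + y)) \o shift c) (h *: 1)
            - f (c *: v + y))) =
  (fun h : R => h^-1 *: ((f \o shift (c *: v + y)) (h *: v) - f (c *: v + y))).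
  apply/funext => h /=; congr (_ *: (f _ - _)).
  by rewrite [_ *: 1]mulr1 scalerDl addrA.
move=> df; apply: DeriveDef.
  by rewrite /derivable E.
by rewrite /derive E.
Qed.

Lemma MVT_line f y v (s : R) : 0 < s ->
  (forall c, 0 <= c <= s -> derivable f (c *: v + y) v) ->
  exists2 c, 0 <= c <= s & f (s *: v + y) - f y = 'D_v f (c *: v + y) * s.
Proof.
move=> s0 df.
have dl (c : R) : c \in `[0, s] ->
    is_derive c 1 (fun t : R => f (t *: v + y)) ('D_v f (c *: v + y)).
  by rewrite in_itv/= => ci; apply/is_derive_line/df.
have dlo (c : R) : c \in `]0, s[ ->
    is_derive c 1 (fun t : R => f (t *: v + y)) ('D_v f (c *: v + y)).
  by move=> ci; apply: dl; apply: subset_itv_oo_cc.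
have cl : {within `[0, s], continuous (fun t : R => f (t *: v + y))}.
  by apply: derivable_within_continuous => c ci; have [] := dl c ci.
have [c ci E] := MVT s0 dlo cl.
exists c; first by have := subset_itv_oo_cc ci; rewrite in_itv.
by rewrite scale0r add0r subr0 in E.
Qed.

(** The second difference over a parallelogram is the increment along [v] of [F], itself a
    difference along [w]. One mean value theorem turns it into an increment of ['D_v f] along [w],
    and another evaluates that increment. *)
Lemma mixed_difference f x v w (s : R) : 0 < s ->
  (forall a b, 0 <= a <= s -> 0 <= b <= s ->
     derivable f (a *: v + (b *: w + x)) v /\
     derivable ('D_v f) (b *: w + (a *: v + x)) w) ->
  exists a b, [/\ 0 <= a <= s, 0 <= b <= s &
    f (s *: v + (s *: w + x)) - f (s *: w + x) - (f (s *: v + x) - f x) =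
    'D_w ('D_v f) (b *: w + (a *: v + x)) * s * s].
Proof.
move=> s0 df.
have z0 : 0 <= (0 : R) <= s by rewrite lexx ltW.
have ss : 0 <= s <= s by rewrite lexx ltW.
pose F y := f (s *: w + y) - f y.
have shiftd c : 0 <= c <= s ->
    is_derive (c *: v + x) v F
      ('D_v f (s *: w + (c *: v + x)) - 'D_v f (c *: v + x)).
  move=> ci.
  have E : s *: w + (c *: v + x) = c *: v + (s *: w + x) by rewrite addrCA.
  have d1 : is_derive (c *: v + x) v (fun y => f (s *: w + y))
              ('D_v f (s *: w + (c *: v + x))).
    have [d _] := df c s ci ss; rewrite -E in d.
    have E2 : (fun h : R => h^-1 *: (((fun y => f (s *: w + y)) \o
                 shift (c *: v + x)) (h *: v) - f (s *: w + (c *: v + x)))) =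
      (fun h : R => h^-1 *: ((f \o shift (s *: w + (c *: v + x))) (h *: v)
                 - f (s *: w + (c *: v + x)))).
      by apply/funext => h /=; rewrite addrCA.
    by apply: DeriveDef; [rewrite /derivable E2|rewrite /derive E2].
  apply: is_deriveB; apply: derivableP.
  by have [] := df c 0 ci z0; rewrite scale0r add0r.
have [|a ai E] := @MVT_line F x v s s0.
  by move=> c ci; have [] := shiftd c ci.
have [_ DE] := shiftd a ai; rewrite DE in E.
have [|b bi E2] := @MVT_line ('D_v f) (a *: v + x) w s s0.
  by move=> c ci; have [] := df a c ai ci.
exists a, b; split => //; rewrite -E2 -E /F.
by rewrite (addrCA (s *: v)); ring.
Qed.

Lemma dist_halves (a b c e : R) : `|a - c| < e / 2 -> `|b - c| < e / 2 ->
  `|a - b| <= e.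
Proof.
move=> ac bc; rewrite (splitr e) (le_trans (ler_distD c _ _))//.
by rewrite (distrC c) lerD// ltW.
Qed.

(** Schwarz's theorem. The second difference does not depend on the order of [v] and [w], so a value
    of [A] and a value of [B] at two points near [x] coincide; continuity of both carries this to
    [x]. *)
Lemma pd_comm (U : set 'rV[R]_n) f i j x : open U -> smooth_on U f -> U x ->
  pd i (pd j f) x = pd j (pd i f) x.
Proof.
move=> openU sf Ux; apply/eqP; rewrite -subr_eq0 -normr_le0.
apply/ler_addgt0Pl => e e0; rewrite addr0.
have e2 : 0 < e / 2 by rewrite divr_gt0.
set A := pd i (pd j f); set B := pd j (pd i f).
have cA : {for x, continuous A}.
  by apply: smooth_continuous Ux; do 2!apply: smooth_pd.
have cB : {for x, continuous B}.
  by apply: smooth_continuous Ux; do 2!apply: smooth_pd.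
have /nbhs_normP[d1 /= d10 sub1] : \forall y \near x, U y by apply: open_nbhs_nbhs.
have /nbhs_normP[d2 /= d20 sub2] : \forall y \near x, `|A x - A y| < e / 2.
  exact: (@cvgr_dist_lt _ _ _ _ _ _ _ cA _ e2).
have /nbhs_normP[d3 /= d30 sub3] : \forall y \near x, `|B x - B y| < e / 2.
  exact: (@cvgr_dist_lt _ _ _ _ _ _ _ cB _ e2).
pose d := Num.min d1 (Num.min d2 d3).
have d0 : 0 < d by rewrite !lt_min d10 d20.
have sub y : `|x - y| < d ->
    [/\ U y, `|A x - A y| < e / 2 & `|B x - B y| < e / 2].
  rewrite !lt_min => /and3P[y1 y2 y3].
  by split; [apply: sub1|apply: sub2|apply: sub3].
pose v : 'rV[R]_n := delta_mx 0 i; pose w : 'rV[R]_n := delta_mx 0 j.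
(* This side length keeps the parallelogram in the ball of radius [d]; the added 1 makes the
   denominator positive and the inclusion strict. *)
pose s := d / (`|v| + `|w| + 1).
have N0 : 0 < `|v| + `|w| + 1 by rewrite ltr_wpDl// addr_ge0.
have s0 : 0 < s by rewrite divr_gt0.
have box a b : 0 <= a <= s -> 0 <= b <= s ->
    [/\ U (a *: v + (b *: w + x)),
      `|A x - A (a *: v + (b *: w + x))| < e / 2 &
      `|B x - B (a *: v + (b *: w + x))| < e / 2].
  move=> /andP[a0 ale] /andP[b0 ble]; apply: sub => /=.
  rewrite addrA opprD addrCA subrr addr0 normrN.
  apply: (le_lt_trans (ler_normD _ _)); rewrite !normrZ !ger0_norm//.
  apply: (@le_lt_trans _ _ (s * (`|v| + `|w|))).
    by rewrite mulrDr lerD// ler_wpM2r.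
  apply: (@lt_le_trans _ _ (s * (`|v| + `|w| + 1))).
    by rewrite ltr_pM2l// ltrDl.
  by rewrite /s divfK// gt_eqF.
have [|a [b [ai bi E1]]] := @mixed_difference f x v w s s0.
  move=> a b ai bi; have [Uab _ _] := box a b ai bi; split.
    exact: smooth_derivable sf Uab.
  by rewrite addrCA; exact: (@smooth_derivable _ _ _ _ j _ (@smooth_pd _ _ _ _ i sf) Uab).
have [|a' [b' [ai' bi' E2]]] := @mixed_difference f x w v s s0.
  move=> a' b' ai' bi'; have [Uab _ _] := box b' a' bi' ai'; split.
    by rewrite addrCA; exact: (smooth_derivable sf Uab).
  exact: (@smooth_derivable _ _ _ _ i _ (@smooth_pd _ _ _ _ j sf) Uab).
have AB : B (b *: w + (a *: v + x)) = A (b' *: v + (a' *: w + x)).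
  apply: (mulIf (lt0r_neq0 s0)); apply: (mulIf (lt0r_neq0 s0)).
  rewrite -[LHS]E1 -[RHS]E2 (addrCA (s *: w)); ring.
have [_ _] := box a b ai bi; rewrite addrCA AB => hB.
have [_ hA _] := box b' a' bi' ai'.
exact: dist_halves hA hB.
Qed.

End MixedPartials.

(** * Curvature in a chart *)

(** The octahedron argument: the four cyclic identities, one for each index in last place, are
    combined linearly after the two skew-symmetries have matched their terms. *)
Lemma pair_symmetry (R : realFieldType) (I : Type) (T : I -> I -> I -> I -> R) :
  (forall j k l m, T j k l m = - T k j l m) ->
  (forall j k l m, T j k l m = - T j k m l) ->
  (forall j k l m, T j k l m + T k l j m + T l j k m = 0) ->
  forall j k l m, T j k l m = T l m j k.
Proof.
move=> A S B j k l m.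
have := B j k l m; have := B k l m j; have := B l m j k; have := B m j k l.
have := S j k m l; have := S k l m j; have := A j l m k; have := S l j m k.
have := S l m k j; have := A k m j l; have := S m k j l; have := S m j l k.
lra.
Qed.

(** * Entrywise calculus of matrix-valued functions *)

Section MatrixCalculus.
Variables (R : realType) (n : nat) (U : set 'rV[R]_n).
Hypothesis openU : open U.

Definition smooth_mx (p q : nat) (A : 'rV[R]_n -> 'M[R]_(p, q)) : Prop :=
  forall a b, smooth_on U (fun x => A x a b).

Definition mpd (p q : nat) (i : 'I_n) (A : 'rV[R]_n -> 'M[R]_(p, q)) x :=
  \matrix_(a, b) pd i (fun y => A y a b) x.

Lemma mpdE p q i (A : 'rV[R]_n -> 'M[R]_(p, q)) x a b :
  mpd i A x a b = pd i (fun y => A y a b) x.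
Proof. by rewrite mxE. Qed.

Lemma smooth_det p (A : 'rV[R]_n -> 'M[R]_p) : smooth_mx A ->
  smooth_on U (fun x => \det (A x)).
Proof.
move=> sA; rewrite /determinant; apply: smooth_sum => // s.
by apply: smoothM => //; [apply: smooth_cst|apply: smooth_prod].
Qed.

(** Cramer's rule: the entries are cofactors divided by the determinant, which does not vanish on
    [U]. *)
Lemma smooth_invmx p (A : 'rV[R]_n -> 'M[R]_p) : smooth_mx A ->
  (forall x, U x -> A x \in unitmx) -> smooth_mx (fun x => invmx (A x)).
Proof.
move=> sA uA a b.
have : smooth_on U (fun x => (\det (A x))^-1 *
    ((-1) ^+ (b + a) * \det (row' b (col' a (A x))))).
  apply: smoothM => //.
    apply: smoothV => //; last exact: smooth_det.
    by move=> x /uA; rewrite unitmxE unitfE.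
  apply: smoothM => //; first exact: smooth_cst.
  by apply: smooth_det => c d; apply: smooth_ext (sA _ _) => // x _; rewrite !mxE.
by apply: smooth_ext => // x Ux; rewrite /invmx uA// !mxE.
Qed.

Lemma smooth_mxD p q (A B : 'rV[R]_n -> 'M[R]_(p, q)) :
  smooth_mx A -> smooth_mx B -> smooth_mx (fun x => A x + B x).
Proof.
move=> sA sB a b; apply: smooth_ext (smoothD _ (sA a b) (sB a b)) => // x _.
by rewrite mxE.
Qed.

Lemma smooth_mxN p q (A : 'rV[R]_n -> 'M[R]_(p, q)) :
  smooth_mx A -> smooth_mx (fun x => - A x).
Proof.
by move=> sA a b; apply: smooth_ext (smoothN _ (sA a b)) => // x _; rewrite mxE.
Qed.

Lemma smooth_mxM p q r (A : 'rV[R]_n -> 'M[R]_(p, q))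
    (B : 'rV[R]_n -> 'M[R]_(q, r)) :
  smooth_mx A -> smooth_mx B -> smooth_mx (fun x => A x *m B x).
Proof.
move=> sA sB a b.
have : smooth_on U (fun x => \sum_c A x a c * B x c b).
  by apply: smooth_sum => // c; apply: smoothM.
by apply: smooth_ext => // x _; rewrite mxE.
Qed.

Lemma smooth_mxT p q (A : 'rV[R]_n -> 'M[R]_(p, q)) :
  smooth_mx A -> smooth_mx (fun x => (A x)^T).
Proof. by move=> sA a b; apply: smooth_ext (sA b a) => // x _; rewrite mxE. Qed.

Lemma smooth_mpd p q i (A : 'rV[R]_n -> 'M[R]_(p, q)) :
  smooth_mx A -> smooth_mx (mpd i A).
Proof.
move=> sA a b; apply: smooth_ext (smooth_pd i (sA a b)) => // x _.
by rewrite mxE.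
Qed.

Lemma mpd_ext p q i (A B : 'rV[R]_n -> 'M[R]_(p, q)) x :
  (forall y, U y -> A y = B y) -> U x -> mpd i A x = mpd i B x.
Proof.
move=> AB Ux; apply/matrixP => a b; rewrite !mxE.
by apply: (pd_ext openU) => // y Uy; rewrite AB.
Qed.

Lemma mpdD p q i (A B : 'rV[R]_n -> 'M[R]_(p, q)) x :
  smooth_mx A -> smooth_mx B -> U x ->
  mpd i (fun y => A y + B y) x = mpd i A x + mpd i B x.
Proof.
move=> sA sB Ux; apply/matrixP => a b; rewrite !mxE -(pdD _ (sA a b) (sB a b))//.
by apply: (pd_ext openU) => // y _; rewrite mxE.
Qed.

Lemma mpdN p q i (A : 'rV[R]_n -> 'M[R]_(p, q)) x :
  smooth_mx A -> U x -> mpd i (fun y => - A y) x = - mpd i A x.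
Proof.
move=> sA Ux; apply/matrixP => a b; rewrite !mxE -(pdN _ (sA a b))//.
by apply: (pd_ext openU) => // y _; rewrite mxE.
Qed.

Lemma mpdM p q r i (A : 'rV[R]_n -> 'M[R]_(p, q))
    (B : 'rV[R]_n -> 'M[R]_(q, r)) x :
  smooth_mx A -> smooth_mx B -> U x ->
  mpd i (fun y => A y *m B y) x = mpd i A x *m B x + A x *m mpd i B x.
Proof.
move=> sA sB Ux; apply/matrixP => a b; rewrite !mxE -big_split/=.
rewrite (@pd_ext _ _ _ openU _ (fun y => \sum_c A y a c * B y c b)) //; last first.
  by move=> y _; rewrite mxE.
rewrite (@pd_sum _ _ _ openU _ _ (fun c y => A y a c * B y c b)) //; last first.
  by move=> c; apply: smoothM.
by apply: eq_bigr => c _; rewrite (pdM _ (sA a c) (sB c b)) // !mxE.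
Qed.

Lemma mpdT p q i (A : 'rV[R]_n -> 'M[R]_(p, q)) x : U x ->
  mpd i (fun y => (A y)^T) x = (mpd i A x)^T.
Proof.
move=> Ux; apply/matrixP => a b; rewrite !mxE.
by apply: (pd_ext openU) => // y _; rewrite mxE.
Qed.

Lemma mpd_comm p q i j (A : 'rV[R]_n -> 'M[R]_(p, q)) x : smooth_mx A -> U x ->
  mpd i (mpd j A) x = mpd j (mpd i A) x.
Proof.
move=> sA Ux; apply/matrixP => a b.
have E c y : mpd c A y a b = pd c (fun z => A z a b) y by rewrite mxE.
transitivity (pd i (pd j (fun y => A y a b)) x).
  by rewrite mxE; apply: (pd_ext openU) => // y _.
transitivity (pd j (pd i (fun y => A y a b)) x).
  exact: (pd_comm i j openU (sA a b) Ux).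
by rewrite [RHS]mxE; apply: (pd_ext openU) => // y _.
Qed.

End MatrixCalculus.

(** * Levi-Civita connection and Riemann tensor in matrix form *)

Section LocalGeometry.
Variables (R : realType) (n : nat) (U : set 'rV[R]_n).
Hypothesis openU : open U.
Variable g : 'rV[R]_n -> 'M[R]_n.
Hypothesis smooth_g : smooth_mx U g.
Hypothesis g_sym : forall x, U x -> (g x)^T = g x.
Hypothesis g_unit : forall x, U x -> g x \in unitmx.
Implicit Types (i j k l m p q : 'I_n) (x : 'rV[R]_n).

(** Rows carry the lower index and columns the upper one, so that nabla_i acts on a column of
    covector components as d_i - [conn i]. *)
Definition conn i x : 'M[R]_n := \matrix_(l, m) christoffel g m i l x.

Lemma connE i x l m : conn i x l m = christoffel g m i l x.
Proof. by rewrite mxE. Qed.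

(** The commutator of d_j - [conn j] and d_k - [conn k]; its entry in row l and column m is
    R_{jkl}^m. *)
Definition curv j k x : 'M[R]_n :=
  mpd k (conn j) x - mpd j (conn k) x + conn j x *m conn k x
  - conn k x *m conn j x.

Definition riem j k l m x : R := (curv j k x *m g x) l m.

Lemma g_symE x i j : U x -> g x i j = g x j i.
Proof. by move=> Ux; rewrite -[in LHS]g_sym // mxE. Qed.

Lemma invmx_sym x : U x -> (invmx (g x))^T = invmx (g x).
Proof. by move=> Ux; rewrite trmx_inv g_sym. Qed.

Lemma ginv_symE x i j : U x -> ginv g i j x = ginv g j i x.
Proof. by move=> Ux; rewrite /ginv -[in LHS]invmx_sym // mxE. Qed.

Lemma ginvKl x i j : U x -> \sum_p ginv g i p x * g x p j = (i == j)%:R.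
Proof.
by move=> Ux; have /matrixP/(_ i j) := mulVmx (g_unit Ux); rewrite !mxE.
Qed.

Lemma ginvKr x i j : U x -> \sum_p g x i p * ginv g p j x = (i == j)%:R.
Proof.
by move=> Ux; have /matrixP/(_ i j) := mulmxV (g_unit Ux); rewrite !mxE.
Qed.

Lemma smooth_ginv i j : smooth_on U (ginv g i j).
Proof. exact: (smooth_invmx openU smooth_g g_unit). Qed.

Lemma smooth_christoffel p i j : smooth_on U (christoffel g p i j).
Proof.
apply: smoothM => //; first exact: smooth_cst.
apply: smooth_sum => // q; apply: smoothM => //; first exact: smooth_ginv.
by apply: smoothB => //; [apply: smoothD => //|]; apply: smooth_pd; apply: smooth_g.
Qed.

Lemma smooth_conn i : smooth_mx U (conn i).
Proof.
move=> a b; apply: smooth_ext (smooth_christoffel b i a) => // x _.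
by rewrite mxE.
Qed.

Lemma pd_g_sym i j k x : U x ->
  pd i (fun y => g y j k) x = pd i (fun y => g y k j) x.
Proof. by move=> Ux; apply: (pd_ext openU) => // y Uy; apply: g_symE. Qed.

Lemma christoffelC p i j x : U x -> christoffel g p i j x = christoffel g p j i x.
Proof.
move=> Ux; congr (_ * _); apply: eq_bigr => q _.
by rewrite (pd_g_sym q i j Ux); congr (_ * _); ring.
Qed.

Lemma christoffel_lower i l m x : U x ->
  \sum_p christoffel g p i l x * g x p m =
  2%:R^-1 * (pd i (fun y => g y m l) x + pd l (fun y => g y m i) x
     - pd m (fun y => g y i l) x).
Proof.
move=> Ux; set B := fun q => pd i (fun y => g y q l) x +
  pd l (fun y => g y q i) x - pd q (fun y => g y i l) x.
transitivity (2%:R^-1 * \sum_p \sum_q (g x m p * ginv g p q x) * B q).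
  rewrite mulr_sumr; apply: eq_bigr => p _.
  rewrite /christoffel -mulrA mulr_suml; congr (_ * _); apply: eq_bigr => q _.
  by rewrite (g_symE m p Ux) -/(B q); ring.
rewrite exchange_big /= (bigD1 m) //= [X in _ + X]big1 ?addr0.
  by rewrite -mulr_suml ginvKr // eqxx mul1r.
move=> q /negPf qm; rewrite -mulr_suml ginvKr // eq_sym qm mul0r.
by [].
Qed.

Local Opaque christoffel.

(** This is nabla g = 0: in the sum of two Christoffel symbols of the first kind all terms cancel
    except two halves of d_i g. From here on the Christoffel symbols enter only through this
    identity, their symmetry and their smoothness. *)
Lemma metric_compatible i x : U x ->
  mpd i g x = conn i x *m g x + g x *m (conn i x)^T.
Proof.
move=> Ux; apply/matrixP => l m; rewrite !mxE.
have -> : \sum_j conn i x l j * g x j m =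
    \sum_p christoffel g p i l x * g x p m.
  by apply: eq_bigr => p _; rewrite mxE.
have -> : \sum_j g x l j * (conn i x)^T j m =
    \sum_p christoffel g p i m x * g x p l.
  by apply: eq_bigr => p _; rewrite !mxE (g_symE l p Ux) mulrC.
rewrite !christoffel_lower // (pd_g_sym i m l Ux) (pd_g_sym l m i Ux).
rewrite (pd_g_sym m l i Ux).
by field.
Qed.

Lemma curvE j k l m x : curv j k x l m =
  pd k (christoffel g m j l) x - pd j (christoffel g m k l) x
  + (\sum_p christoffel g p j l x * christoffel g m k p x)
  - (\sum_p christoffel g p k l x * christoffel g m j p x).
Proof.
have F a : (fun y => conn a y l m) = christoffel g m a l.
  by apply/funext => y; rewrite mxE.
have E a b : (conn a x *m conn b x) l m =
    \sum_p christoffel g p a l x * christoffel g m b p x.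
  by rewrite mxE; apply: eq_bigr => p _; rewrite !mxE.
have D a b : mpd a (conn b) x l m = pd a (christoffel g m b l) x by rewrite mxE F.
have S (V W Y Z : 'M[R]_n) : (V - W + Y - Z) l m = V l m - W l m + Y l m - Z l m.
  by rewrite !mxE.
by rewrite /curv S; congr (_ - _ + _ - _); [exact: D|exact: D|exact: E|exact: E].
Qed.

(** The covector d x^m has constant components, so its first covariant derivative is minus a
    Christoffel symbol. In the commutator, the connection terms attached to the first derivative
    index cancel by symmetry. *)
Lemma riemannE j k l m x : U x -> riemann g j k l m x = curv j k x l m.
Proof.
move=> Ux; rewrite /riemann /commutator.
have -> : nabla1 g (fun q _ => (q == m)%:R : R) =
    fun a b y => - christoffel g m a b y.
  apply/funext => a; apply/funext => b; apply/funext => y.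
  rewrite /nabla1 pd_cst sub0r (bigD1 m) //= eqxx mulr1 big1 ?addr0 //.
  by move=> p /negPf ->; rewrite mulr0.
have N a b : nabla2 g (fun a b y => - christoffel g m a b y) a b l x =
    - pd a (christoffel g m b l) x
    + (\sum_p christoffel g p a b x * christoffel g m p l x)
    + (\sum_p christoffel g p a l x * christoffel g m b p x).
  rewrite /nabla2 (pdN _ (smooth_christoffel _ _ _) Ux).
  by congr (_ + _ + _); rewrite -sumrN; apply: eq_bigr => p _; rewrite mulrN opprK.
rewrite !N curvE.
have -> : \sum_p christoffel g p k j x * christoffel g m p l x =
  \sum_p christoffel g p j k x * christoffel g m p l x.
  by apply: eq_bigr => p _; rewrite (christoffelC _ _ _ Ux).
have aux (a b s t u : R) : - a + s + t - (- b + s + u) = b - a + t - u by ring.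
exact: aux.
Qed.

Lemma smooth_curv j k : smooth_mx U (curv j k).
Proof.
by apply: smooth_mxD => //; [|apply: smooth_mxN => //];
  [apply: smooth_mxD => //; [|]|]; try (apply: smooth_mxM => //; exact: smooth_conn);
  apply: smooth_mxD => //; [|apply: smooth_mxN => //]; apply: smooth_mpd => //;
  exact: smooth_conn.
Qed.

Local Opaque pd mpd.

Lemma curvC j k x : curv j k x = - curv k j x.
Proof.
have aux (V W Y Z : 'M[R]_n) : V - W + Y - Z = - (W - V + Z - Y).
  by apply/matrixP => a b; rewrite !mxE; ring.
exact: aux.
Qed.

Lemma riemE j k l m x : riem j k l m x = \sum_p curv j k x l p * g x p m.
Proof. by rewrite /riem mxE. Qed.

Lemma riemC j k l m x : riem j k l m x = - riem k j l m x.
Proof. by rewrite /riem curvC mulNmx mxE. Qed.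

(* Substituting the metric compatibility twice in the equality of the mixed
   second derivatives of g leaves exactly the curvature terms. *)
Lemma curv_skew j k x : U x -> curv j k x *m g x + (curv j k x *m g x)^T = 0.
Proof.
move=> Ux.
have D a b : mpd a (mpd b g) x =
    mpd a (conn b) x *m g x + conn b x *m (conn a x *m g x + g x *m (conn a x)^T)
    + ((conn a x *m g x + g x *m (conn a x)^T) *m (conn b x)^T
       + g x *m (mpd a (conn b) x)^T).
  rewrite (mpd_ext openU _ (fun y => @metric_compatible b y) Ux).
  have sc := smooth_conn b; have sct := smooth_mxT openU sc.
  have s1 := smooth_mxM openU sc smooth_g; have s2 := smooth_mxM openU smooth_g sct.
  rewrite (mpdD openU a s1 s2 Ux) (mpdM openU a sc smooth_g Ux).
  rewrite (mpdM openU a smooth_g sct Ux) (mpdT openU a (conn b) Ux).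
  by rewrite metric_compatible.
have aux (A B J K G : 'M[R]_n) : G^T = G ->
    K *m G + A *m (B *m G + G *m B^T) + ((B *m G + G *m B^T) *m A^T + G *m K^T) =
    J *m G + B *m (A *m G + G *m A^T) + ((A *m G + G *m A^T) *m B^T + G *m J^T) ->
    (K - J + A *m B - B *m A) *m G + ((K - J + A *m B - B *m A) *m G)^T = 0.
  move=> GT; rewrite trmx_mul GT !(raddfD, raddfN) /= !trmx_mul.
  rewrite !(mulmxDl, mulmxDr, mulNmx, mulmxN) !mulmxA.
  move=> /matrixP H; apply/matrixP => a b; move: (H a b).
  have mD (V W : 'M[R]_n) : (V + W) a b = V a b + W a b by rewrite mxE.
  have mN (V : 'M[R]_n) : (- V) a b = - V a b by rewrite mxE.
  rewrite !(mD, mN) => E; rewrite [RHS]mxE.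
  by move/eqP: E; rewrite -subr_eq0 => /eqP <-; ring.
have C := mpd_comm openU k j smooth_g Ux; rewrite (D k j) (D j k) in C.
exact: aux (g_sym Ux) C.
Qed.

Lemma riem_skew j k l m x : U x -> riem j k l m x = - riem j k m l x.
Proof.
move=> Ux; have /matrixP/(_ l m) := curv_skew j k Ux.
by rewrite /riem !mxE => /eqP; rewrite addr_eq0 => /eqP.
Qed.

Local Opaque curv.

(** Absence of torsion: the derivative terms [P] are symmetric in their last two indices and the
    quadratic terms [S] in their first two, and under these symmetries the cyclic sum cancels in
    pairs. *)
Lemma curv_bianchi1 j k l m x : U x ->
  curv j k x l m + curv k l x j m + curv l j x k m = 0.
Proof.
move=> Ux.
have aux (P S : 'I_n -> 'I_n -> 'I_n -> R) : (forall a b c, P a b c = P a c b) ->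
    (forall a b c, S a b c = S b a c) ->
    P k j l - P j k l + S j l k - S k l j + (P l k j - P k l j + S k j l - S l j k)
    + (P j l k - P l j k + S l k j - S j k l) = 0.
  move=> PC SC; rewrite (PC k j l) (PC j k l) (PC l k j).
  by rewrite (SC j l k) (SC k l j) (SC k j l); ring.
have F a b c : pd a (christoffel g m b c) x = pd a (christoffel g m c b) x.
  by apply: (pd_ext openU) => // y Uy; apply: christoffelC.
have E a b c : \sum_p christoffel g p a b x * christoffel g m c p x =
  \sum_p christoffel g p b a x * christoffel g m c p x.
  by apply: eq_bigr => p _; congr (_ * _); apply: christoffelC.
apply: etrans (aux (fun a b c => pd a (christoffel g m b c) x)
  (fun a b c => \sum_p christoffel g p a b x * christoffel g m c p x) F E).
by congr (_ + _ + _); apply: curvE.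
Qed.

Lemma riem_bianchi1 j k l m x : U x ->
  riem j k l m x + riem k l j m x + riem l j k m x = 0.
Proof.
move=> Ux.
transitivity (\sum_p (curv j k x l p + curv k l x j p + curv l j x k p) * g x p m).
  under eq_bigr => p _ do rewrite !mulrDl.
  by rewrite !big_split /=; congr (_ + _ + _); apply: riemE.
by rewrite big1 // => p _; rewrite curv_bianchi1 // mul0r.
Qed.

Lemma riem_pair j k l m x : U x -> riem j k l m x = riem l m j k x.
Proof.
move=> Ux; apply: (@pair_symmetry _ _ (fun j k l m => riem j k l m x)).
- by move=> *; apply: riemC.
- by move=> *; apply: riem_skew.
- by move=> *; apply: riem_bianchi1.
Qed.

End LocalGeometry.

(** * The second Bianchi identity *)

Section SecondBianchi.
Variables (R : realType) (n : nat) (U : set 'rV[R]_n).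
Hypothesis openU : open U.
Variable g : 'rV[R]_n -> 'M[R]_n.
Hypothesis smooth_g : smooth_mx U g.
Hypothesis g_sym : forall x, U x -> (g x)^T = g x.
Hypothesis g_unit : forall x, U x -> g x \in unitmx.
Implicit Types (i j k l m p q : 'I_n) (x : 'rV[R]_n).
Local Opaque pd mpd christoffel curv conn.

Let smooth_curvg j k : smooth_mx U (curv g j k) :=
  smooth_curv openU smooth_g g_unit j k.
Let smooth_conng i : smooth_mx U (conn g i) := smooth_conn openU smooth_g g_unit i.
Let compat i x : U x -> mpd i g x = conn g i x *m g x + g x *m (conn g i x)^T :=
  @metric_compatible _ _ _ openU _ g_sym g_unit i x.

Lemma smooth_riem j k l m : smooth_on U (riem g j k l m).
Proof. exact: (smooth_mxM openU (smooth_curvg j k) smooth_g). Qed.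

(** The commutator of d_i - [conn i] with [curv j k]. It differentiates covariantly in the two
    matrix indices only; [j] and [k] are treated as labels. *)
Definition dcurv i j k x : 'M[R]_n :=
  mpd i (curv g j k) x + curv g j k x *m conn g i x - conn g i x *m curv g j k x.

(** The Jacobi identity for the operators d_i - [conn i]: second derivatives of the connection
    cancel because partial derivatives commute, the rest by expansion in the matrix ring. *)
Lemma dcurv_cyclic i j k x : U x ->
  dcurv i j k x + dcurv j k i x + dcurv k i j x = 0.
Proof.
move=> Ux.
pose H a b c := mpd a (mpd b (conn g c)) x.
pose D a b := mpd a (conn g b) x.
pose A a := conn g a x.
pose C a b := D b a - D a b + A a *m A b - A b *m A a.
have HC a b c : H a b c = H b a c by apply: (mpd_comm openU a b (smooth_conng c) Ux).
have E a b c : dcurv a b c x = (H a c b - H a b c + (D a b *m A c + A b *m D a c)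
    - (D a c *m A b + A c *m D a b)) + C b c *m A a - A a *m C b c.
  congr (_ + _ - _).
  have s1 := smooth_mpd openU c (smooth_conng b).
  have s2 := smooth_mpd openU b (smooth_conng c).
  have s2N := smooth_mxN openU s2.
  have s12 := smooth_mxD openU s1 s2N.
  have s3 := smooth_mxM openU (smooth_conng b) (smooth_conng c).
  have s4 := smooth_mxM openU (smooth_conng c) (smooth_conng b).
  have s4N := smooth_mxN openU s4.
  have s123 := smooth_mxD openU s12 s3.
  apply: etrans (mpdD openU a s123 s4N Ux) _; congr (_ + _).
    apply: etrans (mpdD openU a s12 s3 Ux) _; congr (_ + _).
      apply: etrans (mpdD openU a s1 s2N Ux) _; congr (_ + _).
      exact: (mpdN openU a s2 Ux).
    exact: (mpdM openU a (smooth_conng b) (smooth_conng c) Ux).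
  apply: etrans (mpdN openU a s4 Ux) _; congr (- _).
  exact: (mpdM openU a (smooth_conng c) (smooth_conng b) Ux).
apply: etrans (congr2 _ (congr2 _ (E i j k) (E j k i)) (E k i j)) _.
rewrite (HC i k j) (HC i j k) (HC j k i) /C.
move: (H k i j) (H j i k) (H k j i) (D i j) (D j i) (D j k) (D k j) (D i k) (D k i)
  (A i) (A j) (A k) => h1 h2 h3 d1 d2 d3 d4 d5 d6 a1 a2 a3.
rewrite !(mulmxDl, mulmxDr, mulNmx, mulmxN) !mulmxA.
apply/matrixP => a b.
have mD (V W : 'M[R]_n) : (V + W) a b = V a b + W a b by rewrite mxE.
have mN (V : 'M[R]_n) : (- V) a b = - V a b by rewrite mxE.
by rewrite !(mD, mN) [RHS]mxE; ring.
Qed.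

(** Metric compatibility absorbs the connection terms of [l] and [m] into [dcurv]. Those of [j] and
    [k] stay outside: they cancel only in the cyclic sum, by symmetry of the Christoffel symbols. *)
Lemma nabla4_riem i j k l m x : U x ->
  nabla4 g (riem g) i j k l m x = (dcurv i j k x *m g x) l m
  - (\sum_p christoffel g p i j x * riem g p k l m x)
  + (\sum_p christoffel g p i k x * riem g p j l m x).
Proof.
move=> Ux.
have aux (D C A G : 'M[R]_n) (s1 s2 : R) :
    (D *m G + C *m (A *m G + G *m A^T)) l m - s1 + s2 - (A *m (C *m G)) l m
      - (C *m G *m A^T) l m =
    ((D + C *m A - A *m C) *m G) l m - s1 + s2.
  rewrite !(mulmxDl, mulmxDr, mulNmx, mulmxN) !mulmxA.
  have mD (V W : 'M[R]_n) : (V + W) l m = V l m + W l m by rewrite mxE.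
  have mN (V : 'M[R]_n) : (- V) l m = - V l m by rewrite mxE.
  by rewrite !(mD, mN); ring.
apply: etrans (aux _ _ _ _ _ _).
rewrite /nabla4; congr (_ - _ + _ - _ - _).
- apply: etrans (esym (mpdE _ _ _ _ _)) _.
  by rewrite (mpdM openU i (smooth_curvg j k) smooth_g Ux) (compat i Ux).
- rewrite -sumrN; apply: eq_bigr => p _.
  by rewrite [in LHS]riemC mulrN opprK.
- by rewrite [RHS]mxE; apply: eq_bigr => p _; rewrite connE.
- by rewrite [RHS]mxE; apply: eq_bigr => p _; rewrite [(_^T) p m]mxE connE mulrC.
Qed.

Lemma riem_bianchi2 i j k l m x : U x ->
  nabla4 g (riem g) i j k l m x + nabla4 g (riem g) j k i l m x
  + nabla4 g (riem g) k i j l m x = 0.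
Proof.
move=> Ux.
pose S a b c := \sum_p christoffel g p a b x * riem g p c l m x.
have SC a b c : S a b c = S b a c.
  apply: eq_bigr => p _; congr (_ * _).
  exact: (christoffelC openU g_sym p a b Ux).
pose X a b c := (dcurv a b c x *m g x) l m.
have E a b c : nabla4 g (riem g) a b c l m x = X a b c - S a b c + S a c b.
  exact: nabla4_riem.
have X0 : X i j k + X j k i + X k i j = 0.
  have aux (D1 D2 D3 G : 'M[R]_n) : D1 + D2 + D3 = 0 ->
      (D1 *m G) l m + (D2 *m G) l m + (D3 *m G) l m = 0.
    move=> D0; have /matrixP/(_ l m) : (D1 + D2 + D3) *m G = 0 by rewrite D0 mul0mx.
    have mD (V W : 'M[R]_n) : (V + W) l m = V l m + W l m by rewrite mxE.
    by rewrite !mulmxDl !mD => ->; rewrite mxE.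
  exact: aux (dcurv_cyclic i j k Ux).
apply: etrans (congr2 _ (congr2 _ (E i j k) (E j k i)) (E k i j)) _.
rewrite (SC i k j) (SC j i k) (SC k j i).
move: (X i j k) (X j k i) (X k i j) (S k i j) (S i j k) (S j k i) X0
  => x1 x2 x3 s1 s2 s3 X0.
have -> : x1 - s2 + s1 + (x2 - s3 + s2) + (x3 - s1 + s3) = x1 + x2 + x3 by ring.
exact: X0.
Qed.

Implicit Types T S : 'I_n -> 'I_n -> 'I_n -> 'I_n -> 'rV[R]_n -> R.

Lemma nabla4_ext T S i j k l m x :
  (forall j k l m y, U y -> T j k l m y = S j k l m y) -> U x ->
  nabla4 g T i j k l m x = nabla4 g S i j k l m x.
Proof.
move=> TS Ux; rewrite /nabla4; congr (_ - _ - _ - _ - _).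
- by apply: (pd_ext openU) => // y Uy; apply: TS.
all: by apply: eq_bigr => p _; congr (_ * _); apply: TS.
Qed.

Lemma nabla4D T S i j k l m x :
  (forall j k l m, smooth_on U (T j k l m)) ->
  (forall j k l m, smooth_on U (S j k l m)) -> U x ->
  nabla4 g (fun j k l m y => T j k l m y + S j k l m y) i j k l m x =
  nabla4 g T i j k l m x + nabla4 g S i j k l m x.
Proof.
move=> sT sS Ux.
have aux (a a' b b' c c' d d' e e' : R) :
  (a + a') - (b + b') - (c + c') - (d + d') - (e + e') =
  (a - b - c - d - e) + (a' - b' - c' - d' - e') by ring.
apply: etrans (aux _ _ _ _ _ _ _ _ _ _); rewrite /nabla4; congr (_ - _ - _ - _ - _).
- exact: (pdD i (sT _ _ _ _) (sS _ _ _ _) Ux).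
all: by rewrite -big_split; apply: eq_bigr => p _; rewrite mulrDr.
Qed.

Lemma nabla4N T i j k l m x :
  (forall j k l m, smooth_on U (T j k l m)) -> U x ->
  nabla4 g (fun j k l m y => - T j k l m y) i j k l m x = - nabla4 g T i j k l m x.
Proof.
move=> sT Ux.
have aux (a b c d e : R) :
  - a - (- b) - (- c) - (- d) - (- e) = - (a - b - c - d - e) by ring.
apply: etrans (aux _ _ _ _ _); rewrite /nabla4; congr (_ - _ - _ - _ - _).
- exact: (pdN i (sT _ _ _ _) Ux).
all: by rewrite -sumrN; apply: eq_bigr => p _; rewrite mulrN.
Qed.

Lemma nabla4_swap12 T i j k l m x :
  nabla4 g (fun j k l m => T k j l m) i j k l m x = nabla4 g T i k j l m x.
Proof. by rewrite /nabla4 -!addrA; congr (_ + _); rewrite addrCA. Qed.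

Lemma nabla4_swap34 T i j k l m x :
  nabla4 g (fun j k l m => T j k m l) i j k l m x = nabla4 g T i j k m l x.
Proof. by rewrite /nabla4 -!addrA; do 3!congr (_ + _); rewrite addrC. Qed.

(** * Covariant derivative of a Kulkarni-Nomizu product with the metric *)

Section MetricTimesTensor.
Variable P : 'I_n -> 'I_n -> 'rV[R]_n -> R.
Hypothesis smooth_P : forall k l, smooth_on U (P k l).

Lemma pd_metric i j m x : U x -> pd i (fun y => g y j m) x =
  (\sum_p christoffel g p i j x * g x p m) + (\sum_p christoffel g p i m x * g x j p).
Proof.
move=> Ux; have /matrixP/(_ j m) := compat i Ux; rewrite mpdE => ->.
rewrite mxE; congr (_ + _); rewrite mxE; apply: eq_bigr => p _.
  by rewrite connE.
by rewrite mxE connE mulrC.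
Qed.

(** Each of the four terms of the Kulkarni-Nomizu product is this tensor with permuted indices, so
    only this one has to be differentiated. *)
Definition gP j k l m y : R := g y j m * P k l y.

Lemma smooth_gP j k l m : smooth_on U (gP j k l m).
Proof. by apply: smoothM => //; apply: smooth_g. Qed.

Lemma nabla4_gP i j k l m x : U x ->
  nabla4 g gP i j k l m x = g x j m * nabla2 g P i k l x.
Proof.
move=> Ux.
have aux (s t G d u v p : R) :
  (s + t) * p + G * d - s * p - G * u - G * v - t * p = G * (d - u - v) by ring.
apply: etrans (aux _ _ _ _ _ _ _); rewrite /nabla4; congr (_ - _ - _ - _ - _).
- transitivity (pd i (fun y => g y j m) x * P k l x + g x j m * pd i (P k l) x).
    exact: (pdM i (smooth_g j m) (smooth_P k l) Ux).
  by congr (_ * _ + _); apply: pd_metric.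
- by rewrite mulr_suml; apply: eq_bigr => p _; rewrite mulrA.
- by rewrite mulr_sumr; apply: eq_bigr => p _; rewrite mulrCA.
- by rewrite mulr_sumr; apply: eq_bigr => p _; rewrite mulrCA.
- by rewrite mulr_suml; apply: eq_bigr => p _; rewrite mulrA.
Qed.

Definition kulkarni j k l m y : R :=
  gP j k l m y - gP k j l m y + gP k j m l y - gP j k m l y.

Lemma smooth_kulkarni j k l m : smooth_on U (kulkarni j k l m).
Proof.
apply: smoothB => //; last exact: smooth_gP.
apply: smoothD => //; last exact: smooth_gP.
by apply: smoothB => //; exact: smooth_gP.
Qed.

Lemma nabla4_kulkarni i j k l m x : U x ->
  nabla4 g kulkarni i j k l m x =
    g x j m * nabla2 g P i k l x - g x k m * nabla2 g P i j l x
    + g x k l * nabla2 g P i j m x - g x j l * nabla2 g P i k m x.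
Proof.
move=> Ux.
pose T1 := fun j k l m => gP j k l m; pose T2 := fun j k l m => gP k j l m.
pose T3 := fun j k l m => gP k j m l; pose T4 := fun j k l m => gP j k m l.
have s1 a b c d : smooth_on U (T1 a b c d) by apply: smooth_gP.
have s2 a b c d : smooth_on U (T2 a b c d) by apply: smooth_gP.
have s3 a b c d : smooth_on U (T3 a b c d) by apply: smooth_gP.
have s4 a b c d : smooth_on U (T4 a b c d) by apply: smooth_gP.
have s2N a b c d : smooth_on U (fun y => - T2 a b c d y) by apply: smoothN.
have s4N a b c d : smooth_on U (fun y => - T4 a b c d y) by apply: smoothN.
have s12 a b c d : smooth_on U (fun y => T1 a b c d y - T2 a b c d y).
  exact: smoothD.
have s123 a b c d : smooth_on U (fun y => T1 a b c d y - T2 a b c d y + T3 a b c d y).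
  exact: smoothD.
apply: etrans (nabla4D i j k l m s123 s4N Ux) _; congr (_ + _).
  apply: etrans (nabla4D i j k l m s12 s3 Ux) _; congr (_ + _).
    apply: etrans (nabla4D i j k l m s1 s2N Ux) _; congr (_ + _).
      exact: nabla4_gP.
    apply: etrans (nabla4N i j k l m s2 Ux) _; congr (- _).
    exact: etrans (nabla4_swap12 gP i j k l m x) (nabla4_gP i k j l m Ux).
  apply: etrans (nabla4_swap12 T4 i j k l m x) _.
  exact: etrans (nabla4_swap34 gP i k j l m x) (nabla4_gP i k j m l Ux).
apply: etrans (nabla4N i j k l m s4 Ux) _; congr (- _).
exact: etrans (nabla4_swap34 gP i j k l m x) (nabla4_gP i j k m l Ux).
Qed.

End MetricTimesTensor.

End SecondBianchi.

(** * The Weyl tensor *)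

Section WeylTensor.
Variables (R : realType) (n : nat) (U : set 'rV[R]_n).
Hypothesis openU : open U.
Variable g : 'rV[R]_n -> 'M[R]_n.
Hypothesis smooth_g : smooth_mx U g.
Hypothesis g_sym : forall x, U x -> (g x)^T = g x.
Hypothesis g_unit : forall x, U x -> g x \in unitmx.
Hypothesis n_ge3 : (3 <= n)%N.
Implicit Types (i j k l m p q : 'I_n) (x : 'rV[R]_n).
Local Opaque pd mpd christoffel curv conn riemann riem.

Lemma sum_delta (I : finType) (j : I) (f : I -> R) :
  \sum_p (j == p)%:R * f p = f j.
Proof.
rewrite (bigD1 j) //= eqxx mul1r big1 ?addr0 // => p /negPf pj.
by rewrite eq_sym pj mul0r.
Qed.

Lemma riem_riemann j k l m x : U x ->
  riem g j k l m x = \sum_p riemann g j k l p x * g x p m.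
Proof.
move=> Ux; apply: etrans (riemE _ _ _ _ _ _) _; apply: eq_bigr => p _.
congr (_ * _); apply: esym; exact: (riemannE openU smooth_g g_sym g_unit j k l p Ux).
Qed.

Lemma riemann_riem j k l m x : U x ->
  riemann g j k l m x = \sum_p riem g j k l p x * ginv g p m x.
Proof.
move=> Ux.
transitivity (\sum_p \sum_q riemann g j k l q x * (g x q p * ginv g p m x)).
  rewrite exchange_big /= -[LHS](sum_delta m (fun q => riemann g j k l q x)).
  apply: eq_bigr => q _; rewrite -mulr_sumr mulrC eq_sym.
  by congr (_ * _); rewrite (ginvKr g_unit).
apply: eq_bigr => p _.
transitivity ((\sum_q riemann g j k l q x * g x q p) * ginv g p m x).
  by rewrite mulr_suml; apply: eq_bigr => q _; rewrite mulrA.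
by congr (_ * _); rewrite -riem_riemann.
Qed.

Lemma smooth_riemann j k l m : smooth_on U (riemann g j k l m).
Proof.
have := smooth_curv openU smooth_g g_unit j k l m.
apply: smooth_ext => // x Ux; apply: esym.
exact: (riemannE openU smooth_g g_sym g_unit j k l m Ux).
Qed.

Lemma smooth_ricci k l : smooth_on U (ricci g k l).
Proof. by apply: smoothN => //; apply: smooth_sum => // m; apply: smooth_riemann. Qed.

Lemma smooth_scalar_curvature : smooth_on U (scalar_curvature g).
Proof.
apply: smooth_sum => // i; apply: smooth_sum => // j; apply: smoothM => //.
  exact: (smooth_ginv openU smooth_g g_unit).
exact: smooth_ricci.
Qed.

(** Pair symmetry followed by both skew-symmetries reverses the four indices of the Riemann tensor;
    the inverse metric that traces the outer two is symmetric. *)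
Lemma ricci_sym k l x : U x -> ricci g k l x = ricci g l k x.
Proof.
move=> Ux; congr (- _).
have E a b : \sum_m riemann g m a b m x =
    \sum_m \sum_p riem g m a b p x * ginv g p m x.
  by apply: eq_bigr => m _; apply: riemann_riem.
rewrite (E k l) (E l k) exchange_big /=; apply: eq_bigr => p _.
apply: eq_bigr => m _; congr (_ * _); last exact: (ginv_symE g_sym).
apply: etrans (riem_pair openU smooth_g g_sym g_unit m k l p Ux) _.
apply: etrans (riemC _ _ _ _ _ _) _.
by rewrite (riem_skew openU smooth_g g_sym g_unit p l m k Ux) opprK.
Qed.

Lemma ricci_mixed_lower j m x : U x ->
  \sum_p ricci_mixed g j p x * g x p m = ricci g j m x.
Proof.
move=> Ux.
transitivity (\sum_p \sum_q ricci g j q x * (ginv g q p x * g x p m)).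
  apply: eq_bigr => p _; rewrite /ricci_mixed mulr_suml.
  by apply: eq_bigr => q _; rewrite mulrA.
rewrite exchange_big /= -[RHS](sum_delta m (fun q => ricci g j q x)).
apply: eq_bigr => q _; rewrite -mulr_sumr mulrC eq_sym; congr (_ * _).
exact: (ginvKl g_unit).
Qed.

(** The factor 1/2 compensates for the product of the metric with itself, in which each product of
    metric components occurs twice. *)
Definition schouten k l x : R :=
  (n%:R - 2%:R)^-1 * ricci g k l x -
  2%:R^-1 * ((n%:R - 1) * (n%:R - 2%:R))^-1 * scalar_curvature g x * g x k l.

Lemma schouten_sym k l x : U x -> schouten k l x = schouten l k x.
Proof. by move=> Ux; rewrite /schouten (ricci_sym _ _ Ux) (g_symE g_sym k l Ux). Qed.

Lemma smooth_schouten k l : smooth_on U (schouten k l).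
Proof.
apply: smoothB => //; apply: smoothM => //; try exact: smooth_cst.
- exact: smooth_ricci.
- by apply: smoothM => //; [exact: smooth_cst|exact: smooth_scalar_curvature].
Qed.

(** Linearity of lowering the last index, stated for arbitrary families so that induction on the
    list of indices leaves only ring identities. *)
Lemma weyl_sum (r d1 d2 e f G : 'I_n -> R) (a b S u v w z : R) :
  \sum_p (r p + a * (d1 p * u - d2 p * v + e p * w - f p * z)
          - S * ((d1 p * w - d2 p * z) * b)) * G p =
  (\sum_p r p * G p) + a * ((\sum_p d1 p * G p) * u - (\sum_p d2 p * G p) * v
     + (\sum_p e p * G p) * w - (\sum_p f p * G p) * z)
  - S * (((\sum_p d1 p * G p) * w - (\sum_p d2 p * G p) * z) * b).
Proof.
elim: (index_enum _) => [|p s IH]; first by rewrite !big_nil; ring.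
by rewrite !big_cons IH; ring.
Qed.

Lemma weyl_decomposition j k l m x : U x ->
  weyl g j k l m x = riem g j k l m x + kulkarni g schouten j k l m x.
Proof.
move=> Ux; apply: etrans (weyl_sum _ _ _ _ _ _ _ _ _ _ _ _ _) _.
have aux (r a b S gjm gkl gkm gjl Rkl Rjl Rjm Rkm : R) :
  r + a * (gjm * Rkl - gkm * Rjl + Rjm * gkl - Rkm * gjl)
    - S * ((gjm * gkl - gkm * gjl) * b) =
  r + (gjm * (a * Rkl - 2%:R^-1 * b * S * gkl)
    - gkm * (a * Rjl - 2%:R^-1 * b * S * gjl)
    + gkl * (a * Rjm - 2%:R^-1 * b * S * gjm)
    - gjl * (a * Rkm - 2%:R^-1 * b * S * gkm)) by field.
apply: etrans (aux _ _ _ _ _ _ _ _ _ _ _ _).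
congr (_ + _ * (_ * _ - _ * _ + _ * _ - _ * _) - _ * ((_ * _ - _ * _) * _)).
- by rewrite -riem_riemann.
- exact: (sum_delta j (fun p => g x p m)).
- exact: (sum_delta k (fun p => g x p m)).
- exact: ricci_mixed_lower.
- exact: ricci_mixed_lower.
- exact: (sum_delta j (fun p => g x p m)).
- exact: (sum_delta k (fun p => g x p m)).
Qed.

Lemma ricci_mixed_trace x : U x ->
  \sum_j ricci_mixed g j j x = scalar_curvature g x.
Proof.
move=> Ux; apply: eq_bigr => j _; apply: eq_bigr => p _.
by rewrite mulrC (ginv_symE g_sym p j Ux).
Qed.

(** The trace is -Ric + ((n - 2) Ric + R g)/(n - 2) - R g/(n - 2), where one n comes from delta_j^j
    and two Ricci terms are subtracted from it. *)
Lemma weyl_mixed_trace k l x : U x -> \sum_j weyl_mixed g j k l j x = 0.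
Proof.
move=> Ux.
have n1 : (n%:R - 1 : R) != 0.
  by rewrite -(natrB _ (ltnW (ltnW n_ge3))) pnatr_eq0 -lt0n subn_gt0 ltnW.
have n2 : (n%:R - 2%:R : R) != 0.
  by rewrite -(natrB _ (ltnW n_ge3)) pnatr_eq0 -lt0n subn_gt0.
pose a : R := (n%:R - 2%:R)^-1; pose b : R := ((n%:R - 1) * (n%:R - 2%:R))^-1.
transitivity (\sum_j riemann g j k l j x
  + a * (n%:R * ricci g k l x - (\sum_j (k == j)%:R * ricci g j l x)
    + (\sum_j ricci_mixed g j j x) * g x k l
    - (\sum_j ricci_mixed g k j x * g x j l))
  - scalar_curvature g x * ((n%:R * g x k l - (\sum_j (k == j)%:R * g x j l)) * b)).
  have -> : (n%:R : R) = \sum_(j < n) 1 by rewrite sumr_const card_ord.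
  have aux (s : seq 'I_n) (r d1 d2 e f h c : 'I_n -> R) (S u w : R) :
     (forall j, d1 j = 1) ->
     \sum_(p <- s) (r p + a * (d1 p * u - d2 p * h p + e p * w - f p)
          - S * ((d1 p * w - d2 p * c p) * b)) =
     (\sum_(p <- s) r p) + a * ((\sum_(p <- s) 1) * u - (\sum_(p <- s) d2 p * h p)
     + (\sum_(p <- s) e p) * w - (\sum_(p <- s) f p))
     - S * (((\sum_(p <- s) 1) * w - (\sum_(p <- s) d2 p * c p)) * b).
    move=> d1E; elim: s => [|p s IH]; first by rewrite !big_nil; ring.
    by rewrite !big_cons IH d1E; ring.
  apply: (aux (index_enum _) (fun j => riemann g j k l j x) (fun j => (j == j)%:R)
    (fun j => (k == j)%:R) (fun j => ricci_mixed g j j x)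
    (fun j => ricci_mixed g k j x * g x j l) (fun j => ricci g j l x)
    (fun j => g x j l)) => j.
  by rewrite eqxx.
rewrite !sum_delta ricci_mixed_lower // ricci_mixed_trace //.
have -> : \sum_j riemann g j k l j x = - ricci g k l x by rewrite opprK.
rewrite /a /b; move: (ricci g k l x) (scalar_curvature g x) (g x k l) => r s t.
by field; rewrite n1 n2.
Qed.

Lemma weyl_traceless k l x : U x ->
  \sum_j \sum_m ginv g j m x * weyl g j k l m x = 0.
Proof.
move=> Ux; rewrite -[RHS](weyl_mixed_trace k l Ux); apply: eq_bigr => j _.
transitivity (\sum_m \sum_p weyl_mixed g j k l p x * (g x p m * ginv g m j x)).
  apply: eq_bigr => m _; rewrite mulr_sumr; apply: eq_bigr => p _.
  by rewrite (ginv_symE g_sym j m Ux); ring.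
rewrite exchange_big /= -[RHS](sum_delta j (fun p => weyl_mixed g j k l p x)).
apply: eq_bigr => p _; rewrite -mulr_sumr mulrC eq_sym; congr (_ * _).
exact: (ginvKr g_unit).
Qed.

Lemma weylC j k l m x : U x -> weyl g j k l m x = - weyl g k j l m x.
Proof.
move=> Ux; rewrite !weyl_decomposition // riemC /kulkarni opprD; congr (_ + _).
by ring.
Qed.

Lemma weyl_skew j k l m x : U x -> weyl g j k l m x = - weyl g j k m l x.
Proof.
move=> Ux; rewrite !weyl_decomposition //.
rewrite (riem_skew openU smooth_g g_sym g_unit j k l m Ux) /kulkarni opprD.
by congr (_ + _); ring.
Qed.

Lemma weyl_pair j k l m x : U x -> weyl g j k l m x = weyl g l m j k x.
Proof.
move=> Ux; rewrite !weyl_decomposition //.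
rewrite (riem_pair openU smooth_g g_sym g_unit j k l m Ux); congr (_ + _).
rewrite /kulkarni /gP (schouten_sym k l Ux) (schouten_sym j l Ux).
rewrite (schouten_sym k m Ux) (schouten_sym j m Ux).
rewrite (g_symE g_sym j m Ux) (g_symE g_sym k m Ux) (g_symE g_sym k l Ux).
by rewrite (g_symE g_sym j l Ux); ring.
Qed.

Definition cotton j k l x : R :=
  nabla2 g schouten j k l x - nabla2 g schouten k j l x.

(** The Riemann part drops out. In the Kulkarni-Nomizu part, the derivatives of the Schouten tensor
    that multiply a given metric component come in skew pairs, which are Cotton tensors. *)
Lemma weyl_bianchi2 i j k l m x : U x ->
  nabla4 g (weyl g) i j k l m x + nabla4 g (weyl g) j k i l m x
  + nabla4 g (weyl g) k i j l m x =
  - (g x i m * cotton j k l x - g x i l * cotton j k m x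
     + g x j m * cotton k i l x - g x j l * cotton k i m x
     + g x k m * cotton i j l x - g x k l * cotton i j m x).
Proof.
move=> Ux.
have E a b c : nabla4 g (weyl g) a b c l m x =
    nabla4 g (riem g) a b c l m x + nabla4 g (kulkarni g schouten) a b c l m x.
  transitivity (nabla4 g (fun j k l m y =>
      riem g j k l m y + kulkarni g schouten j k l m y) a b c l m x).
    apply: (nabla4_ext openU) => // j' k' l' m' y Uy.
    exact: weyl_decomposition.
  have sT j' k' l' m' : smooth_on U (riem g j' k' l' m').
    exact: (smooth_riem openU smooth_g g_unit).
  have sS j' k' l' m' : smooth_on U (kulkarni g schouten j' k' l' m').
    exact: (smooth_kulkarni openU smooth_g smooth_schouten).
  exact: (@nabla4D _ _ U g (riem g) (kulkarni g schouten) a b c l m x sT sS Ux).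
have K a b c := nabla4_kulkarni openU smooth_g g_sym g_unit smooth_schouten a b c l m Ux.
have B := riem_bianchi2 openU smooth_g g_sym g_unit i j k l m Ux.
apply: etrans (congr2 _ (congr2 _ (E i j k) (E j k i)) (E k i j)) _.
rewrite (K i j k) (K j k i) (K k i j).
have aux (r1 r2 r3 a b c d : R) : r1 + r2 + r3 = 0 -> a + b + c = d ->
  (r1 + a) + (r2 + b) + (r3 + c) = d.
  by move=> r0 <-; rewrite -[RHS]add0r -r0; ring.
apply: (aux _ _ _ _ _ _ _ B).
have aux2 (N : 'I_n -> 'I_n -> 'I_n -> R) (G : 'I_n -> 'I_n -> R) :
    (G j m * N i k l - G k m * N i j l + G k l * N i j m - G j l * N i k m)
    + (G k m * N j i l - G i m * N j k l + G i l * N j k m - G k l * N j i m)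
    + (G i m * N k j l - G j m * N k i l + G j l * N k i m - G i l * N k j m) =
    - (G i m * (N j k l - N k j l) - G i l * (N j k m - N k j m)
     + G j m * (N k i l - N i k l) - G j l * (N k i m - N i k m)
     + G k m * (N i j l - N j i l) - G k l * (N i j m - N j i m)) by ring.
exact: (aux2 (fun a b c => nabla2 g schouten a b c x) (g x)).
Qed.

End WeylTensor.

(** * Tensor contractions *)

Section Contraction.
Variables (R : realFieldType) (n : nat).
Implicit Types (X : 'rV[R]_n) (f : 'I_n -> R) (F : 'I_n -> 'I_n -> R).

(** Fills one index slot with a vector; nested uses turn an identity between components into one
    between multilinear forms, slot by slot. *)
Definition ev X f : R := \sum_i X 0 i * f i.

Lemma eq_ev X f h : f =1 h -> ev X f = ev X h.
Proof. by move=> fh; apply: eq_bigr => i _; rewrite fh. Qed.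

Lemma evD X f h : ev X (fun i => f i + h i) = ev X f + ev X h.
Proof. by rewrite /ev -big_split; apply: eq_bigr => i _; rewrite mulrDr. Qed.

Lemma evN X f : ev X (fun i => - f i) = - ev X f.
Proof. by rewrite /ev -sumrN; apply: eq_bigr => i _; rewrite mulrN. Qed.

Lemma evZl X (c : R) f : ev X (fun i => c * f i) = c * ev X f.
Proof. by rewrite /ev mulr_sumr; apply: eq_bigr => i _; rewrite mulrCA. Qed.

Lemma evZr X (c : R) f : ev X (fun i => f i * c) = ev X f * c.
Proof. by rewrite /ev mulr_suml; apply: eq_bigr => i _; rewrite mulrA. Qed.

Lemma ev0 X : ev X (fun=> 0) = 0.
Proof. by rewrite /ev big1 // => i _; rewrite mulr0. Qed.

Lemma ev_exchange X Y F :
  ev X (fun i => ev Y (fun j => F i j)) = ev Y (fun j => ev X (fun i => F i j)).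
Proof.
rewrite /ev; under eq_bigr => i _ do rewrite mulr_sumr.
rewrite exchange_big /=; apply: eq_bigr => j _; rewrite mulr_sumr.
by apply: eq_bigr => i _; rewrite mulrCA.
Qed.

Lemma ev_sum (I : finType) X (F : I -> 'I_n -> R) :
  ev X (fun i => \sum_a F a i) = \sum_a ev X (F a).
Proof.
by rewrite /ev exchange_big /=; apply: eq_bigr => i _; rewrite mulr_sumr.
Qed.

Definition ctr (H : 'M[R]_n) F : R := \sum_i \sum_m H i m * F i m.

Lemma eq_ctr H F K : (forall i m, F i m = K i m) -> ctr H F = ctr H K.
Proof. by move=> FK; apply: eq_bigr => i _; apply: eq_bigr => m _; rewrite FK. Qed.

Lemma ctrD H F K : ctr H (fun i m => F i m + K i m) = ctr H F + ctr H K.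
Proof.
rewrite /ctr -big_split; apply: eq_bigr => i _ /=.
by rewrite -big_split; apply: eq_bigr => m _; rewrite mulrDr.
Qed.

Lemma ctrN H F : ctr H (fun i m => - F i m) = - ctr H F.
Proof.
rewrite /ctr -sumrN; apply: eq_bigr => i _.
by rewrite -sumrN; apply: eq_bigr => m _; rewrite mulrN.
Qed.

Lemma ctrZ H c F : ctr H (fun i m => c * F i m) = c * ctr H F.
Proof.
rewrite /ctr mulr_sumr; apply: eq_bigr => i _.
by rewrite mulr_sumr; apply: eq_bigr => m _; rewrite mulrCA.
Qed.

Lemma ctr_ev H X (F : 'I_n -> 'I_n -> 'I_n -> R) :
  ctr H (fun i m => ev X (F i m)) = ev X (fun p => ctr H (fun i m => F i m p)).
Proof.
rewrite /ctr ev_sum; apply: eq_bigr => i _; rewrite ev_sum.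
by apply: eq_bigr => m _; rewrite evZl.
Qed.

(** * Traces of the Bianchi identity of a recurrent Weyl tensor *)

Section Inverse.
Variables (G H : 'M[R]_n).
Hypotheses (HG : H *m G = 1%:M) (Gsym : G^T = G) (Hsym : H^T = H).

Let HsymE i j : H i j = H j i. Proof. by rewrite -[in LHS]Hsym mxE. Qed.
Let GsymE i j : G i j = G j i. Proof. by rewrite -[in LHS]Gsym mxE. Qed.

Lemma ctr_metric_l l f : ctr H (fun i m => G i l * f m) = f l.
Proof.
rewrite /ctr exchange_big /=.
transitivity (\sum_m (m == l)%:R * f m).
  apply: eq_bigr => m _; have /matrixP/(_ m l) := HG; rewrite !mxE => <-.
  by rewrite mulr_suml; apply: eq_bigr => i _; rewrite mulrA (HsymE i).
rewrite (bigD1 l) //= eqxx mul1r big1 ?addr0 // => m /negPf ->.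
by rewrite mul0r.
Qed.

Lemma ctr_metric_r j f : ctr H (fun i m => G j m * f i) = f j.
Proof.
rewrite -[RHS](ctr_metric_l j f) /ctr exchange_big /=; apply: eq_bigr => i _.
by apply: eq_bigr => m _; rewrite HsymE GsymE.
Qed.

Lemma ctr_metric : ctr H (fun i m => G i m) = n%:R.
Proof.
rewrite /ctr -[n in RHS]card_ord -sumr_const; apply: eq_bigr => i _.
have /matrixP/(_ i i) := HG; rewrite !mxE eqxx mulr1n => <-.
by apply: eq_bigr => m _; rewrite GsymE.
Qed.

Variable C : 'I_n -> 'I_n -> 'I_n -> 'I_n -> R.
Hypothesis C12 : forall j k l m, C j k l m = - C k j l m.
Hypothesis C34 : forall j k l m, C j k l m = - C j k m l.
Hypothesis Ctr : forall k l, ctr H (fun j m => C j k l m) = 0.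
Variables (a : 'I_n -> R) (Y : 'I_n -> 'I_n -> 'I_n -> R) (ell : 'rV[R]_n).
Hypothesis ellE : forall m, ell 0 m = \sum_i H i m * a i.
Hypothesis Y12 : forall j k l, Y j k l = - Y k j l.
Hypothesis bianchi : forall i j k l m,
  a i * C j k l m + a j * C k i l m + a k * C i j l m =
  - (G i m * Y j k l - G i l * Y j k m + G j m * Y k i l - G j l * Y k i m
     + G k m * Y i j l - G k l * Y i j m).
Hypothesis n_ge3 : (3 <= n)%N.

(** Of the metric terms, one contracts to n times [Y j k l] and three to its opposite, whence n - 3.
    The last two retain the trace [y] of the Cotton tensor, not yet known to vanish. *)
Lemma bianchi_trace j k l : let y k := ctr H (fun i m => Y k i m) in
  ev ell (C j k l) = - ((n%:R - 3%:R) * Y j k l - G j l * y k + G k l * y j).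
Proof.
move=> y.
have E1 : ctr H (fun i m => a i * C j k l m) = ev ell (C j k l).
  rewrite /ctr exchange_big; apply: eq_bigr => m _ /=.
  by rewrite ellE mulr_suml; apply: eq_bigr => i _; rewrite mulrA.
have E2 : ctr H (fun i m => a j * C k i l m) = 0.
  rewrite ctrZ (eq_ctr _ (K := fun i m => - C i k l m)) => [|i m].
    by rewrite ctrN Ctr oppr0 mulr0.
  exact: C12.
have E3 : ctr H (fun i m => a k * C i j l m) = 0 by rewrite ctrZ Ctr mulr0.
have F1 : ctr H (fun i m => G i m * Y j k l) = n%:R * Y j k l.
  rewrite (eq_ctr _ (K := fun i m => Y j k l * G i m)) => [|i m].
    by rewrite ctrZ ctr_metric mulrC.
  exact: mulrC.
have F2 : ctr H (fun i m => G i l * Y j k m) = Y j k l.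
  exact: (ctr_metric_l l (fun m => Y j k m)).
have F3 : ctr H (fun i m => G j m * Y k i l) = - Y j k l.
  by rewrite (ctr_metric_r j (fun i => Y k i l)) Y12.
have F4 : ctr H (fun i m => G j l * Y k i m) = G j l * y k by rewrite ctrZ.
have F5 : ctr H (fun i m => G k m * Y i j l) = - Y j k l.
  by rewrite (ctr_metric_r k (fun i => Y i j l)) Y12.
have F6 : ctr H (fun i m => G k l * Y i j m) = - (G k l * y j).
  rewrite ctrZ (eq_ctr _ (K := fun i m => - Y j i m)) => [|i m].
    by rewrite ctrN mulrN.
  exact: Y12.
have := eq_ctr H (fun i m => bianchi i j k l m).
by rewrite !(ctrD, ctrN) E1 E2 E3 F1 F2 F3 F4 F5 F6 => E; move: E; lra.
Qed.

Lemma cotton_divergence j k l : ev ell (C j k l) = - ((n%:R - 3%:R) * Y j k l).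
Proof.
pose y k := ctr H (fun i m => Y k i m).
have n2 : (n%:R - 2%:R : R) != 0.
  by rewrite -(natrB _ (ltnW n_ge3)) pnatr_eq0 -lt0n subn_gt0.
have y0 i : y i = 0.
  (* A second trace, over the two remaining free indices, annihilates the left-hand side and leaves
     2 (n - 2) [y i] on the right. *)
  have D0 : ctr H (fun k l => ev ell (C i k l)) = 0.
    rewrite ctr_ev (eq_ev _ (h := fun=> 0)) ?ev0 // => m.
    rewrite (eq_ctr _ (K := fun k l => C k i m l)) ?Ctr // => p q.
    by rewrite C12 C34 opprK.
  have := eq_ctr H (fun k l => bianchi_trace i k l).
  rewrite D0 /= -/y !(ctrN, ctrD) ctrZ -/(y i).
  rewrite (ctr_metric_r i (fun k => ctr H (fun i m => Y k i m))) -/(y i).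
  rewrite (eq_ctr _ (K := fun k l => y i * G k l)) => [|p q]; last exact: mulrC.
  rewrite ctrZ ctr_metric => E.
  by apply: (mulfI n2); rewrite mulr0; move: E; lra.
by rewrite bianchi_trace -/(y k) -/(y j) !y0; ring.
Qed.

(** The three vectors annihilated by [a] remove the terms a_i C, a_j C and a_k C one after the
    other; [V] and [W] remain arbitrary. *)
Lemma transverse_identity (X Y' Z V W : 'rV[R]_n) :
  ev X a = 0 -> ev Y' a = 0 -> ev Z a = 0 ->
  let g U V := ev U (fun i => ev V (G i)) in
  let D U V W := ev U (fun j => ev V (fun k => ev W (fun l => ev ell (C j k l)))) in
  g X W * D Y' Z V - g X V * D Y' Z W - g Y' W * D X Z V + g Y' V * D X Z W
  + g Z W * D X Y' V - g Z V * D X Y' W = 0.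
Proof.
move=> Xa Ya Za g D.
pose d j k l := ev ell (C j k l).
(* Multiplying by n - 3 turns every Cotton component into a component of [d], which eliminates [Y]
   without a division. *)
have I i j k l m : (n%:R - 3%:R) *
    (a i * C j k l m - a j * C i k l m + a k * C i j l m) =
    G i m * d j k l - G i l * d j k m - G j m * d i k l + G j l * d i k m
    + G k m * d i j l - G k l * d i j m.
  rewrite /d !cotton_divergence; have := bianchi i j k l m.
  rewrite (C12 k i) (Y12 k i l) (Y12 k i m) => E.
  have -> : a i * C j k l m - a j * C i k l m + a k * C i j l m =
    a i * C j k l m + a j * - C i k l m + a k * C i j l m by ring.
  by rewrite E; ring.
pose gW i := ev W (G i); pose gV i := ev V (G i).
pose C1 j k l := ev W (C j k l); pose C2 j k := ev V (C1 j k).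
pose dW j k := ev W (d j k); pose dV j k := ev V (d j k).
pose c : R := n%:R - 3%:R.
have I1 i j k l : c * (a i * C1 j k l - a j * C1 i k l + a k * C1 i j l) =
    gW i * d j k l - G i l * dW j k - gW j * d i k l + G j l * dW i k
    + gW k * d i j l - G k l * dW i j.
  by have := eq_ev W (I i j k l); rewrite !(evZl, evD, evN, evZr) => E; exact: E.
have I2 i j k : c * (a i * C2 j k - a j * C2 i k + a k * C2 i j) =
    gW i * dV j k - gV i * dW j k - gW j * dV i k + gV j * dW i k
    + gW k * dV i j - gV k * dW i j.
  by have := eq_ev V (I1 i j k); rewrite !(evZl, evD, evN, evZr) => E; exact: E.
have I3 i j : c * (a i * ev Z (C2 j) - a j * ev Z (C2 i)) =
    gW i * ev Z (dV j) - gV i * ev Z (dW j) - gW j * ev Z (dV i)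
    + gV j * ev Z (dW i) + ev Z gW * dV i j - ev Z gV * dW i j.
  have := eq_ev Z (I2 i j); rewrite !(evZl, evD, evN, evZr) Za mul0r addr0.
  by move=> E; exact: E.
have I4 i : c * (a i * ev Y' (fun j => ev Z (C2 j))) =
    gW i * ev Y' (fun j => ev Z (dV j)) - gV i * ev Y' (fun j => ev Z (dW j))
    - ev Y' gW * ev Z (dV i) + ev Y' gV * ev Z (dW i) + ev Z gW * ev Y' (dV i)
    - ev Z gV * ev Y' (dW i).
  have := eq_ev Y' (I3 i); rewrite !(evZl, evD, evN, evZr) Ya mul0r subr0.
  by move=> E; exact: E.
have := eq_ev X I4; rewrite !(evZl, evD, evN, evZr) Xa mul0r mulr0 => E.
exact: esym E.
Qed.

End Inverse.
End Contraction.

Section FrameComponents.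
Variables (R : realFieldType) (n : nat).
Implicit Types (C : 'I_n -> 'I_n -> 'I_n -> 'I_n -> R) (u v w z : 'rV[R]_n).

Definition ev4 C u v w z : R :=
  ev u (fun j => ev v (fun k => ev w (fun l => ev z (C j k l)))).

Lemma ev4_swap12 C u v w z : (forall j k l m, C j k l m = - C k j l m) ->
  ev4 C u v w z = - ev4 C v u w z.
Proof.
move=> C12; rewrite /ev4 [in RHS]ev_exchange -evN; apply: eq_ev => j.
rewrite -evN; apply: eq_ev => k; rewrite -evN; apply: eq_ev => l.
by rewrite -evN; apply: eq_ev => m.
Qed.

Lemma ev4_swap34 C u v w z : (forall j k l m, C j k l m = - C j k m l) ->
  ev4 C u v w z = - ev4 C u v z w.
Proof.
move=> C34; rewrite /ev4 -evN; apply: eq_ev => j.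
rewrite -evN; apply: eq_ev => k; rewrite [in RHS]ev_exchange.
by rewrite -evN; apply: eq_ev => l; rewrite -evN; apply: eq_ev => m.
Qed.

Lemma ev4_pair C u v w z : (forall j k l m, C j k l m = C l m j k) ->
  ev4 C u v w z = ev4 C w z u v.
Proof.
move=> Cp; rewrite /ev4.
transitivity (ev w (fun l => ev u (fun j => ev v (fun k => ev z (C j k l))))).
  rewrite [RHS]ev_exchange; apply: eq_ev => j; exact: ev_exchange.
apply: eq_ev => l.
transitivity (ev u (fun j => ev z (fun m => ev v (fun k => C j k l m)))).
  by apply: eq_ev => j; apply: ev_exchange.
rewrite ev_exchange; apply: eq_ev => m; apply: eq_ev => j; apply: eq_ev => k.
exact: Cp.
Qed.

End FrameComponents.

(** * Vanishing of components in a null frame *)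

Section NullFrameAlgebra.
Variables (R : realFieldType) (V : Type) (k : nat).
Variables (T : V -> V -> V -> V -> R) (g : V -> V -> R).
Variables (ell nu : V) (e : 'I_k -> V).
Hypothesis k_ge3 : (3 <= k)%N.
Hypothesis T12 : forall u v w z, T u v w z = - T v u w z.
Hypothesis T34 : forall u v w z, T u v w z = - T u v z w.
Hypothesis Tpair : forall u v w z, T u v w z = T w z u v.
Hypothesis Ttr : forall v w,
  T ell v w nu + T nu v w ell + \sum_a T (e a) v w (e a) = 0.
Hypothesis gll : g ell ell = 0.
Hypothesis gln : g ell nu = 1.
Hypothesis gle : forall a, g ell (e a) = 0.
Hypothesis gen : forall a, g (e a) nu = 0.
Hypothesis gee : forall a b, g (e a) (e b) = (a == b)%:R.
Hypothesis ident : forall x y z v w,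
  g ell x = 0 -> g ell y = 0 -> g ell z = 0 ->
  g x w * T y z v ell - g x v * T y z w ell - g y w * T x z v ell
  + g y v * T x z w ell + g z w * T x y v ell - g z v * T x y w ell = 0.

(** The number [k] of transverse vectors is n - 2, so this is the constant n - 4. *)
Let k2 : (k%:R - 2%:R : R) != 0.
Proof. by rewrite -(natrB _ (ltnW k_ge3)) pnatr_eq0 -lt0n subn_gt0. Qed.

Let T11 v w z : T v v w z = 0.
Proof. have := T12 v v w z; lra. Qed.

Let sum_deltar (b : 'I_k) (f : 'I_k -> R) : \sum_a (a == b)%:R * f a = f b.
Proof.
rewrite (bigD1 b) //= eqxx mul1r big1 ?addr0 // => a /negPf ->.
by rewrite mul0r.
Qed.

Let sum_cst (c : R) : \sum_(a < k) c = k%:R * c.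
Proof. by rewrite sumr_const card_ord mulr_natl. Qed.

(** The identity on (ell, e_a, e_b) expresses the components [H] through the present one. Their
    transverse trace brings the factor -(k - 1), and the vanishing trace of [T] relates it back to
    the component itself. *)
Lemma boost_weight1 b : T ell (e b) nu ell = 0.
Proof.
have H a c : T (e a) (e b) (e c) ell =
    - (a == c)%:R * T ell (e b) nu ell + (b == c)%:R * T ell (e a) nu ell.
  have := ident nu (e c) gll (gle a) (gle b).
  by rewrite gle gln !gee !gen; move=> E; move: E; lra.
have H2 : \sum_a T (e a) (e b) (e a) ell = - (k%:R - 1) * T ell (e b) nu ell.
  transitivity (\sum_a (- T ell (e b) nu ell
      + (a == b)%:R * T ell (e a) nu ell)).
    by apply: eq_bigr => a _; rewrite H eqxx (eq_sym b) mulN1r.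
  by rewrite big_split /= sum_cst (sum_deltar b (fun a => T ell (e a) nu ell)); ring.
have := Ttr (e b) ell; rewrite (T34 ell _ ell) (T34 nu _ ell ell).
have -> : T nu (e b) ell ell = 0 by have := T34 nu (e b) ell ell; lra.
rewrite (eq_bigr (fun a => - T (e a) (e b) (e a) ell)) => [|a _]; last exact: T34.
rewrite sumrN H2 => E; apply: (mulfI k2); rewrite mulr0; move: E; lra.
Qed.

Lemma boost_weight1_transverse a b c : T (e a) (e b) (e c) ell = 0.
Proof.
have := ident nu (e c) gll (gle a) (gle b).
rewrite gle gln !gee !gen !boost_weight1; lra.
Qed.

(** Both free arguments of the identity are transverse here, and one of them is summed against e_a.
    Two deltas each return the component; the third multiplies the transverse trace, which is zero
    because [T] is traceless. *)
Lemma boost_weight2 b c : T ell (e b) (e c) ell = 0.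
Proof.
have tr0 : \sum_a T ell (e a) (e a) ell = 0.
  have := Ttr ell ell; rewrite !T11 (T34 nu ell) (T34 nu ell ell ell).
  have -> : T nu ell ell ell = 0 by have := T34 nu ell ell ell; lra.
  rewrite (eq_bigr (fun a => T ell (e a) (e a) ell)) => [|a _]; first by lra.
  by rewrite Tpair T12 T34 opprK Tpair T12 T34 opprK.
have E a : - T ell (e b) (e c) ell + (a == c)%:R * T ell (e b) (e a) ell
   + (a == b)%:R * T ell (e a) (e c) ell - (b == c)%:R * T ell (e a) (e a) ell = 0.
  have := ident (e c) (e a) gll (gle a) (gle b).
  by rewrite !gle !gee eqxx mulr1n (eq_sym b a); lra.
have : \sum_a (- T ell (e b) (e c) ell + (a == c)%:R * T ell (e b) (e a) ell
   + (a == b)%:R * T ell (e a) (e c) ell - (b == c)%:R * T ell (e a) (e a) ell) = 0.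
  by rewrite big1.
rewrite sumrB !big_split /= -mulr_sumr tr0 sum_cst.
rewrite (sum_deltar c (fun a => T ell (e b) (e a) ell)).
rewrite (sum_deltar b (fun a => T ell (e a) (e c) ell)) => S.
by apply: (mulfI k2); rewrite mulr0; move: S; lra.
Qed.

(** The identity on (e_a, e_b, e_c) is summed over a; the two deltas contribute equally, by
    skew-symmetry in [b] and [c]. *)
Lemma boost_weight0_d b c : T (e b) (e c) nu ell = 0.
Proof.
have E a : - T (e b) (e c) nu ell + (a == b)%:R * T (e a) (e c) nu ell
   - (a == c)%:R * T (e a) (e b) nu ell = 0.
  have := ident (e a) nu (gle a) (gle b) (gle c).
  by rewrite !gen !gee eqxx mulr1n (eq_sym b a) (eq_sym c a); lra.
have : \sum_a (- T (e b) (e c) nu ell + (a == b)%:R * T (e a) (e c) nu ell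
   - (a == c)%:R * T (e a) (e b) nu ell) = 0 by rewrite big1.
rewrite sumrB !big_split /= sum_cst.
rewrite (sum_deltar b (fun a => T (e a) (e c) nu ell)).
rewrite (sum_deltar c (fun a => T (e a) (e b) nu ell)) (T12 (e c)) => S.
by apply: (mulfI k2); rewrite mulr0; move: S; lra.
Qed.

Lemma null_frame_type_IId :
  [/\ forall a b, T ell (e a) ell (e b) = 0,
      forall a, T ell nu ell (e a) = 0,
      forall a b c, T ell (e a) (e b) (e c) = 0 &
      forall a b, T ell nu (e a) (e b) = 0].
Proof.
split=> [a b|a|a b c|a b].
- by rewrite T34 boost_weight2 oppr0.
- by rewrite Tpair T34 boost_weight1 oppr0.
- by rewrite Tpair T34 boost_weight1_transverse oppr0.
- by rewrite Tpair T34 boost_weight0_d oppr0.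
Qed.

End NullFrameAlgebra.

(** * Null frames of a Lorentzian form *)

Lemma char_poly_conj (F : fieldType) n (P A : 'M[F]_n) : P \in unitmx ->
  char_poly (invmx P *m A *m P) = char_poly A.
Proof.
move=> Pu; rewrite /char_poly /char_poly_mx !map_mxM /=.
set Q := map_mx _ (invmx P); set Q' := map_mx _ P; set A' := map_mx _ A.
have QQ : Q *m Q' = 1%:M by rewrite -map_mxM mulVmx // map_mx1.
have -> : 'X%:M - Q *m A' *m Q' = Q *m ('X%:M - A') *m Q'.
  rewrite mulmxBr mulmxBl; congr (_ - _).
  by rewrite scalar_mxC -mulmxA QQ mulmx1.
by rewrite !det_mulmx mulrAC -det_mulmx QQ det1 mul1r.
Qed.

Section LorentzianForm.
Variables (R : realType) (n : nat).
Implicit Types (G : 'M[R]_n) (u v w : 'rV[R]_n).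

Lemma innerE G u v : inner G u v = (u *m G *m v^T) 0 0.
Proof.
rewrite /inner mxE exchange_big /=; apply: eq_bigr => j _.
by rewrite !mxE mulr_suml; apply: eq_bigr => i _; rewrite [G i j * _]mulrC.
Qed.

Lemma innerC G u v : G^T = G -> inner G u v = inner G v u.
Proof.
move=> GT; rewrite /inner exchange_big; apply: eq_bigr => j _ /=.
apply: eq_bigr => i _; rewrite -[in LHS]GT mxE; ring.
Qed.

Lemma innerDl G u v w : inner G (u + v) w = inner G u w + inner G v w.
Proof. by rewrite !innerE !mulmxDl mxE. Qed.

Lemma innerZl G (c : R) u w : inner G (c *: u) w = c * inner G u w.
Proof. by rewrite !innerE -!scalemxAl mxE. Qed.

Lemma innerDr G u v w : inner G w (u + v) = inner G w u + inner G w v.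
Proof. by rewrite !innerE raddfD /= mulmxDr mxE. Qed.

Lemma innerZr G (c : R) u w : inner G w (c *: u) = c * inner G w u.
Proof. by rewrite !innerE linearZ /= -scalemxAr mxE. Qed.

Lemma lorentzian_size G s :
  char_poly G = \prod_(a <- s) ('X - a%:P) -> size s = n.
Proof.
by move=> E; have := size_char_poly G; rewrite E size_prod_XsubC => -[].
Qed.

(** One negative and n - 1 positive roots already exhaust the n roots of the characteristic
    polynomial, which leaves no room for the eigenvalue 0. *)
Lemma lorentzian_unit G : (0 < n)%N -> lorentzian_mx G -> G \in unitmx.
Proof.
move=> n0 [_ [s [cp neg pos]]]; have ss := lorentzian_size cp.
rewrite -row_free_unit -kermx_eq0; apply: contraT => ker0.
have : root (char_poly G) 0.
  by rewrite -eigenvalue_root_char /eigenvalue /eigenspace raddf0 subr0.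
rewrite cp root_prod_XsubC => s0.
have : (count (fun a : R => a < 0)%R s + count (fun a : R => 0 < a)%R s
        + count (pred1 0%R) s <= size s)%N.
  elim: s {cp neg pos ss s0} => //= a s IH.
  by case: (ltgtP a 0) IH => _ IH; rewrite ?eqxx /=; lia.
have : (0 < count (pred1 0%R) s)%N by rewrite -has_count has_pred1.
by rewrite neg pos ss; move: n0; lia.
Qed.

Import Num.Def.
Local Notation toC := (real_complex R).
Local Open Scope sesquilinear_scope.

(** The complexified matrix is Hermitian, hence unitarily diagonalizable. Its diagonal entries must
    be the given real roots up to order, so exactly one index, [i0], carries an entry that is not
    positive. *)
Lemma lorentzian_spectral G : (0 < n)%N -> lorentzian_mx G ->
  exists (P : 'M[R[i]]_n) (d : 'rV[R[i]]_n) (i0 : 'I_n),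
    [/\ P \is unitarymx, map_mx toC G = P^t* *m diag_mx d *m P &
        forall i, i != i0 -> 0 < d 0 i].
Proof.
move=> n0 [GT [s [cp neg pos]]]; have ss := lorentzian_size cp.
set A := map_mx toC G.
have AH : A \is hermsymmx.
  apply: realsym_hermsym.
    apply/is_hermitianmxP; rewrite expr0 scale1r map_mx_id //.
    by rewrite /A map_trmx GT.
  by apply/mxOverP => i j; rewrite mxE; apply/complex_realP; exists (G i j).
have := hermitian_normalmx AH => /orthomx_spectralP.
set P := spectralmx A; set d := spectral_diag A => AE.
have Pu : P \is unitarymx := spectral_unitarymx A.
have Punit := unitarymx_unit Pu.
have cpA : char_poly A = \prod_(i < n) ('X - (d 0 i)%:P).
  rewrite AE char_poly_conj // char_poly_trig ?diag_mx_is_trig //.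
  by apply: eq_bigr => i _; rewrite mxE eqxx mulr1n.
have cps : char_poly A = \prod_(a <- [seq toC a | a <- s]) ('X - a%:P).
  rewrite -map_char_poly cp rmorph_prod big_map; apply: eq_bigr => a _.
  by rewrite rmorphB /= map_polyX map_polyC.
have perm : perm_eq [seq toC a | a <- s] [seq d 0 i | i <- enum 'I_n].
  by apply: prod_XsubC_eq; rewrite -cps cpA [RHS]big_map big_enum.
have : count (fun a => 0 < a) [seq d 0 i | i <- enum 'I_n] = n.-1.
  rewrite -(seq.permP perm) count_map -pos; apply: eq_count => a /=.
  by rewrite ltcR.
rewrite count_map => cnt.
have c1 : #|[pred i | ~~ (0 < d 0 i)]| = 1%N.
  have := cardC [pred i | 0 < d 0 i]; rewrite card_ord.
  have -> : #|[pred i | 0 < d 0 i]| = n.-1.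
    by rewrite -cnt cardE size_filter -enumT.
  by move=> E; apply: (@addnI n.-1); rewrite addn1 prednK // -[RHS]E.
have [i0 i0P] := mem_card1 c1.
exists P, d, i0; split => //; first by rewrite -invmx_unitary.
move=> i ii0; have := i0P i; rewrite !inE (negbTE ii0).
by move=> /negbFE.
Qed.

(* Some complex combination of u and w has no component along the only
   eigenvector with a nonpositive eigenvalue, so the form is nonnegative on it;
   but it is also nonpositive on the span of u and w. *)
Lemma lorentzian_nonpos_orthogonal G u w : (0 < n)%N -> lorentzian_mx G ->
  inner G u u < 0 -> inner G u w = 0 -> inner G w w <= 0 -> w = 0.
Proof.
move=> n0 GL uu uw ww; have [GT _] := GL.
have [P [d [i0 [Pu GE dpos]]]] := lorentzian_spectral n0 GL.
pose A := map_mx toC G; pose c (v : 'rV[R]_n) : 'rV[R[i]]_n := map_mx toC v.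
pose h (v v' : 'rV[R[i]]_n) := (v *m A *m v'^t*) 0 0.
pose y (v : 'rV[R[i]]_n) := v *m P^t*.
have PP : P^t* *m P = 1%:M by rewrite -invmx_unitary // mulVmx // unitarymx_unit.
have cT v : (c v)^t* = map_mx toC v^T.
  apply/matrixP => i j; rewrite !mxE conj_Creal //.
  by apply/complex_realP; exists (v j i).
have hc v v' : h (c v) (c v') = toC (inner G v v').
  by rewrite /h cT innerE -!map_mxM mxE.
have mZ p q (a : R[i]) (M : 'M[R[i]]_(p, q)) i j : (a *: M) i j = a * M i j.
  by rewrite mxE.
have hDl (a b : R[i]) (v v' z : 'rV[R[i]]_n) : h (a *: v + b *: v') z = a * h v z + b * h v' z.
  by rewrite /h !mulmxDl -!scalemxAl mxE !mZ.
have hDr (a b : R[i]) (v v' z : 'rV[R[i]]_n) : h z (a *: v + b *: v') = a^* * h z v + b^* * h z v'.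
  rewrite /h; have -> : (a *: v + b *: v')^t* = a^* *: v^t* + b^* *: v'^t*.
    by apply/matrixP => i j; rewrite !mxE rmorphD !rmorphM.
  by rewrite mulmxDr -!scalemxAr mxE !mZ.
have hy (v : 'rV[R[i]]_n) : h v v = \sum_i d 0 i * (y v 0 i * (y v 0 i)^*).
  have -> : h v v = (y v *m diag_mx d *m (y v)^t*) 0 0.
    by rewrite /h /A GE /y trmx_mul map_mxM trmxCK !mulmxA.
  rewrite mxE; apply: eq_bigr => i _.
  by rewrite mul_mx_diag !mxE mulrA [d 0 i * _]mulrC.
have hpos (v : 'rV[R[i]]_n) : y v 0 i0 = 0 -> 0 <= h v v /\ (h v v <= 0 -> v = 0).
  move=> y0; have t0 i : 0 <= d 0 i * (y v 0 i * (y v 0 i)^*).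
    have [->|ii0] := eqVneq i i0; first by rewrite y0 mul0r mulr0.
    by rewrite mulr_ge0 ?mul_conjC_ge0 // ltW ?dpos.
  rewrite hy; split; first exact: sumr_ge0.
  move=> le0; have /eqP : \sum_i d 0 i * (y v 0 i * (y v 0 i)^*) = 0.
    by apply/eqP; rewrite eq_le le0 sumr_ge0.
  rewrite psumr_eq0 // => /allP H.
  have yv0 : y v = 0.
    apply/rowP => i; rewrite [RHS]mxE; have [->|ii0] := eqVneq i i0; first by [].
    have := H i (mem_index_enum i); rewrite mulf_eq0 gt_eqF ?dpos //= mul_conjC_eq0.
    by move/eqP.
  by rewrite -[v]mulmx1 -PP mulmxA -/(y v) yv0 mul0mx.
pose p := y (c u) 0 i0; pose q := y (c w) 0 i0.
have [p0|p0] := eqVneq p 0.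
  have [+ _] := hpos (c u) p0; rewrite hc (_ : 0 = toC 0) // lecR.
  by rewrite leNgt uu.
pose v := q *: c u + (- p) *: c w.
have wu : inner G w u = 0 by rewrite innerC.
have yv : y v 0 i0 = 0.
  rewrite /y /v mulmxDl -!scalemxAl mxE !mZ -/(y _) -/(y _) -/p -/q.
  by ring.
have [_ hv0] := hpos v yv.
have v0 : v = 0.
  apply: hv0; rewrite /v hDl !hDr !hc uw wu !rmorph0 !mulr0 addr0 add0r.
  rewrite !mulrA -[leRHS](addr0 0); apply: lerD.
    rewrite mulr_ge0_le0 ?mul_conjC_ge0 // (_ : 0 = toC 0) // lecR ltW //.
  by rewrite mulr_ge0_le0 ?mul_conjC_ge0 // (_ : 0 = toC 0) // lecR.
have q0 : q = 0.
  have : h v (c u) = 0 by rewrite v0 /h !mul0mx mxE.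
  rewrite /v hDl !hc wu rmorph0 mulr0 addr0 => /eqP; rewrite mulf_eq0.
  case/orP => [/eqP //|]; rewrite (_ : 0 = toC 0) // => /eqP/complexI uu0.
  by rewrite uu0 ltxx in uu.
have : (- p) *: c w = 0 by rewrite -v0 /v q0 scale0r add0r.
move/eqP; rewrite scaler_eq0 oppr_eq0 (negbTE p0) /= => /eqP /matrixP cw.
by apply/rowP => i; apply: complexI; have := cw 0 i; rewrite !mxE.
Qed.

End LorentzianForm.

(** * Construction and completeness of null frames *)

Section NullFrames.
Variables (R : realType).

(** Fewer than n linear conditions on n unknowns: the matrix [M] of the conditions has a nonzero
    left kernel. *)
Lemma exists_orthogonal n (G : 'M[R]_n) (I : finType) (f : I -> 'rV[R]_n) :
  (#|I| < n)%N -> exists2 w, w != 0 & forall a, inner G w (f a) = 0.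
Proof.
move=> In; pose M := \matrix_(i < n, a < #|I|) (G *m (f (enum_val a))^T) i 0.
have : kermx M != 0.
  by rewrite -mxrank_eq0 mxrank_ker -lt0n subn_gt0 (leq_ltn_trans (rank_leq_col M)).
case/rowV0Pn => w /sub_kermxP wM w0; exists w => // a.
have /rowP/(_ (enum_rank a)) := wM; rewrite !mxE => <-.
rewrite innerE -mulmxA mxE; apply: eq_bigr => i _.
by rewrite [M _ _]mxE enum_rankK.
Qed.

Variables (k : nat) (G : 'M[R]_k.+2) (ell : 'rV[R]_k.+2).
Hypotheses (GL : lorentzian_mx G) (ell0 : ell != 0) (ell_null : inner G ell ell = 0).

Let Gsym : G^T = G. Proof. by have [] := GL. Qed.

Lemma exists_null_dual : exists nu : 'rV[R]_k.+2,
  [/\ nu != 0, inner G nu nu = 0 & inner G ell nu = 1].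
Proof.
have [v v1] : exists v, inner G ell v = 1.
  have : ell *m G != 0.
    by rewrite mulmx_free_eq0 // row_free_unit lorentzian_unit.
  case/rV0Pn => j lj; exists (((ell *m G) 0 j)^-1 *: delta_mx 0 j).
  by rewrite innerZr innerE trmx_delta -colE [col _ _ _ _]mxE mulVf.
(* Adding c ell keeps the product with ell equal to 1 and changes the square of [v] by 2 c. *)
pose nu := v + (- (inner G v v / 2%:R)) *: ell.
have lnu : inner G ell nu = 1 by rewrite innerDr innerZr ell_null mulr0 addr0.
exists nu; split => //.
  by apply: contra_eq_neq lnu => ->; rewrite innerE trmx0 mulmx0 mxE eq_sym oner_eq0.
rewrite {1}/nu innerDl innerZl lnu /nu innerDr innerZr.
by rewrite (innerC v ell Gsym) v1; field.
Qed.

Variable nu : 'rV[R]_k.+2.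
Hypotheses (nu_null : inner G nu nu = 0) (ell_nu : inner G ell nu = 1).

Lemma transverse_pos w : w != 0 -> inner G w ell = 0 -> inner G w nu = 0 ->
  0 < inner G w w.
Proof.
move=> w0 wl wn; rewrite ltNge; apply: contraNN w0 => ww; apply/eqP.
(* The vector ell - nu has square -2, and [w] is orthogonal to it. *)
apply: (@lorentzian_nonpos_orthogonal _ _ G (ell + (- 1) *: nu)) => //.
  rewrite innerDl !innerDr !innerZl !innerZr (innerC nu ell Gsym).
  by rewrite ell_null ell_nu nu_null; lra.
by rewrite innerDl innerZl (innerC _ _ Gsym) wl (innerC _ _ Gsym) wn; lra.
Qed.

(** One vector is added at a time: m + 2 orthogonality conditions leave a nonzero solution while m <
    k, and [transverse_pos] allows it to be normalized. Indexing by [nat] lets the family be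
    extended; its values from [m] on are meaningless. *)
Lemma exists_transverse_frame m : (m <= k)%N -> exists e : nat -> 'rV[R]_k.+2,
  (forall a, (a < m)%N -> inner G ell (e a) = 0 /\ inner G nu (e a) = 0) /\
  (forall a b, (a < m)%N -> (b < m)%N -> inner G (e a) (e b) = (a == b)%:R).
Proof.
elim: m => [|m IH] mk; first by exists (fun=> 0); split.
have [e [e_perp e_orth]] := IH (ltnW mk).
pose f (a : option (option 'I_m)) : 'rV[R]_k.+2 :=
  if a is Some b then (if b is Some c then e c else nu) else ell.
have [|w w0 wf] := @exists_orthogonal _ G _ f.
  by rewrite !card_option card_ord.
have wl : inner G w ell = 0 := wf None.
have wn : inner G w nu = 0 := wf (Some None).
have we a : (a < m)%N -> inner G w (e a) = 0.
  by move=> am; apply: (wf (Some (Some (Ordinal am)))).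
have ww := transverse_pos w0 wl wn.
pose w1 := (Num.sqrt (inner G w w))^-1 *: w.
have w1w1 : inner G w1 w1 = 1.
  rewrite innerZl innerZr mulrA -invfM -expr2 sqr_sqrtr ?ltW //.
  by rewrite mulVf // gt_eqF.
exists (fun a => if a == m then w1 else e a); split.
  move=> a; rewrite ltnS leq_eqVlt; case: eqP => [-> _|_ /= am]; last exact: e_perp.
  by rewrite !innerZr !(innerC _ w Gsym) wl wn mulr0.
move=> a b; rewrite (ltnS a) (leq_eqVlt a) (ltnS b) (leq_eqVlt b) => la lb.
have [am|am] := eqVneq a m; have [bm|bm] := eqVneq b m.
- by rewrite w1w1 am bm eqxx.
- by rewrite innerZl we ?mulr0 ?am 1?eq_sym ?(negbTE bm) //; move: lb; rewrite (negbTE bm).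
- rewrite innerZr (innerC _ _ Gsym) we ?mulr0 ?bm ?(negbTE am) //.
  by move: la; rewrite (negbTE am).
- by apply: e_orth; [move: la; rewrite (negbTE am)|move: lb; rewrite (negbTE bm)].
Qed.

Variable e : 'I_k -> 'rV[R]_k.+2.
Hypothesis e_perp : forall a, inner G ell (e a) = 0 /\ inner G nu (e a) = 0.
Hypothesis e_orth : forall a b, inner G (e a) (e b) = (a == b)%:R.

(** If the rows of [B] are the frame, then [B G B^T] is the Gram matrix [eta], which is its own
    inverse. Hence the inverse of [G] is [B^T eta B], expanded here into frame vectors. *)
Lemma null_frame_complete i m : invmx G i m =
  ell 0 i * nu 0 m + nu 0 i * ell 0 m + \sum_a e a 0 i * e a 0 m.
Proof.
pose E : 'M[R]_(k, k.+2) := \matrix_(a, j) e a 0 j.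
have rE a : row a E = e a by apply/rowP => j; rewrite !mxE.
pose N : 'M[R]_(1 + 1, k.+2) := col_mx ell nu.
pose S : 'M[R]_(1 + 1) := block_mx 0 1%:M 1%:M 0.
pose B : 'M[R]_(1 + 1 + k, k.+2) := col_mx N E.
pose eta : 'M[R]_(1 + 1 + k) := block_mx S 0 0 1%:M.
have s11 (u v : 'rV[R]_k.+2) : u *m G *m v^T = (inner G u v)%:M.
  by rewrite innerE -mx11_scalar.
have EE u : (forall a, inner G u (e a) = 0) -> u *m G *m E^T = 0.
  move=> ue; apply/rowP => a; rewrite [RHS]mxE -(ue a) innerE [LHS]mxE [RHS]mxE.
  by apply: eq_bigr => j _; congr (_ * _); rewrite !mxE.
have NGN : N *m G *m N^T = S.
  rewrite /N tr_col_mx mul_col_mx mul_col_row !s11 ell_null nu_null ell_nu.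
  have z0 : 0%:M = 0 :> 'M[R]_1 by apply/matrixP => a b; rewrite !mxE mul0rn.
  by rewrite (innerC nu ell Gsym) ell_nu /S !z0.
have NGE : N *m G *m E^T = 0.
  rewrite /N !mul_col_mx !EE ?col_mx0 // => a; by have [] := e_perp a.
have EGN : E *m G *m N^T = 0.
  by apply: trmx_inj; rewrite !trmx_mul trmxK Gsym mulmxA NGE trmx0.
have EGE : E *m G *m E^T = 1%:M.
  apply/matrixP => a b; rewrite [RHS]mxE -(e_orth a b) innerE [LHS]mxE [RHS]mxE.
  apply: eq_bigr => j _; congr (_ * _); last by rewrite !mxE.
  by rewrite !mxE; apply: eq_bigr => l _; rewrite !mxE.
have BGB : B *m G *m B^T = eta.
  by rewrite /B tr_col_mx mul_col_mx mul_col_row NGN NGE EGN EGE.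
have SS : S *m S = 1%:M.
  rewrite /S mulmx_block !mul0mx !mulmx0 !mulmx1 !(addr0, add0r).
  by rewrite -scalar_mx_block.
have etaeta : eta *m eta = 1%:M.
  rewrite /eta mulmx_block !mul0mx !mulmx0 !mulmx1 !(addr0, add0r) SS.
  by rewrite -scalar_mx_block.
(* [B] is square, [1 + 1 + k] being convertible to [k.+2], so a right inverse of [B] is also a left
   inverse. *)
have BB : (G *m (B^T *m eta)) *m B = 1%:M.
  apply: (@mulmx1C _ k.+2); by rewrite !mulmxA BGB.
have inv : invmx G = B^T *m eta *m B.
  have Gu : G \in unitmx by apply: lorentzian_unit.
  by rewrite -[RHS](mulKmx Gu) [G *m (_ *m _)]mulmxA BB mulmx1.
have -> : invmx G = nu^T *m ell + ell^T *m nu + E^T *m E.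
  rewrite inv /B /eta tr_col_mx mul_row_block !mulmx0 mulmx1 addr0 add0r mul_row_col.
  congr (_ + _); rewrite /N /S tr_col_mx mul_row_block !mulmx0 !mulmx1 addr0 add0r.
  by rewrite mul_row_col.
have dE (u v : 'rV[R]_k.+2) : (u^T *m v) i m = u 0 i * v 0 m.
  by rewrite mxE big_ord1 mxE.
have mD (A A' : 'M[R]_k.+2) : (A + A') i m = A i m + A' i m by rewrite mxE.
rewrite !mD !dE [nu 0 i * _ + _]addrC; congr (_ + _).
by rewrite mxE; apply: eq_bigr => a _; rewrite !mxE.
Qed.

End NullFrames.

(** * Type II_d *)

Section PointwiseType.
Variables (R : realType) (k : nat) (G : 'M[R]_k.+2).
Variables (C : 'I_k.+2 -> 'I_k.+2 -> 'I_k.+2 -> 'I_k.+2 -> R).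
Variables (a : 'I_k.+2 -> R) (Y : 'I_k.+2 -> 'I_k.+2 -> 'I_k.+2 -> R).
Hypotheses (k_ge3 : (3 <= k)%N) (GL : lorentzian_mx G).
Hypothesis C12 : forall j k l m, C j k l m = - C k j l m.
Hypothesis C34 : forall j k l m, C j k l m = - C j k m l.
Hypothesis Cpair : forall j k l m, C j k l m = C l m j k.
Hypothesis Ctr : forall k l, \sum_j \sum_m invmx G j m * C j k l m = 0.
Hypothesis Y12 : forall j k l, Y j k l = - Y k j l.
Hypothesis a0 : exists i, a i != 0.
Hypothesis a_null : \sum_i \sum_j invmx G i j * a i * a j = 0.
Hypothesis bianchi : forall i j k l m,
  a i * C j k l m + a j * C k i l m + a k * C i j l m =
  - (G i m * Y j k l - G i l * Y j k m + G j m * Y k i l - G j l * Y k i m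
     + G k m * Y i j l - G k l * Y i j m).

Lemma eval4E (u v w z : 'rV[R]_k.+2) : eval4 C u v w z = ev4 C u v w z.
Proof.
rewrite /eval4 /ev4 /ev; apply: eq_bigr => j _; rewrite mulr_sumr.
apply: eq_bigr => p _; rewrite mulr_sumr mulr_sumr; apply: eq_bigr => l _.
rewrite !mulr_sumr; apply: eq_bigr => m _; ring.
Qed.

Lemma innerEv (u v : 'rV[R]_k.+2) : inner G u v = ev u (fun i => ev v (G i)).
Proof.
rewrite /inner /ev; apply: eq_bigr => j _; rewrite mulr_sumr.
by apply: eq_bigr => p _; ring.
Qed.

Lemma pointwise_type_IId : at_least_type_IId G C.
Proof.
have [Gsym _] := GL; have Gu : G \in unitmx by apply: lorentzian_unit.
have HG : invmx G *m G = 1%:M by rewrite mulVmx.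
have Hsym : (invmx G)^T = invmx G by rewrite trmx_inv Gsym.
pose ell : 'rV[R]_k.+2 := (\row_i a i) *m invmx G.
have ellE m : ell 0 m = \sum_i invmx G i m * a i.
  by rewrite mxE; apply: eq_bigr => i _; rewrite mxE mulrC.
have ellG : ell *m G = \row_i a i by rewrite /ell mulmxKV.
have ell0 : ell != 0.
  have [i ai] := a0; apply: contra_neq ai => e0.
  by have /rowP/(_ i) := ellG; rewrite e0 mul0mx !mxE.
have ell_a X : inner G ell X = ev X a.
  by rewrite innerE ellG mxE; apply: eq_bigr => i _; rewrite !mxE mulrC.
have ell_null : inner G ell ell = 0.
  rewrite ell_a -[RHS]a_null exchange_big; apply: eq_bigr => j _ /=.
  by rewrite ellE mulr_suml.
have [nu [nu0 nu_null ell_nu]] := exists_null_dual GL ell0 ell_null.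
have [e' [e'_perp e'_orth]] :=
  exists_transverse_frame GL ell_null nu_null ell_nu (leqnn k).
pose e (b : 'I_k) := e' b.
have e_perp b : inner G ell (e b) = 0 /\ inner G nu (e b) = 0 by apply: e'_perp.
have e_orth b c : inner G (e b) (e c) = (b == c)%:R by apply: e'_orth.
have HE := null_frame_complete GL ell_null nu_null ell_nu e_perp e_orth.
pose T := ev4 C.
have T12 u v w z : T u v w z = - T v u w z by apply: ev4_swap12.
have T34 u v w z : T u v w z = - T u v z w by apply: ev4_swap34.
have Tp u v w z : T u v w z = T w z u v by apply: ev4_pair.
(* The frame expansion [HE] of the inverse metric turns the vanishing trace of [C] into a sum over
   ell, nu and the transverse vectors. *)
have Ttr v w : T ell v w nu + T nu v w ell + \sum_b T (e b) v w (e b) = 0.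
  pose F j m := ev v (fun p => ev w (fun l => C j p l m)).
  have TF u z : T u v w z = \sum_j \sum_m u 0 j * z 0 m * F j m.
    rewrite /T /ev4; apply: eq_bigr => j _.
    transitivity (u 0 j * ev z (F j)).
      congr (_ * _); apply: esym; apply: etrans (ev_exchange _ _ _) _.
      by apply: eq_ev => p; apply: ev_exchange.
    by rewrite mulr_sumr; apply: eq_bigr => m _; rewrite mulrA.
  have F0 : ctr (invmx G) F = 0.
    rewrite /F ctr_ev -[RHS](ev0 v); apply: eq_ev => p.
    rewrite ctr_ev -[RHS](ev0 w); apply: eq_ev => l.
    exact: Ctr.
  have -> : \sum_b T (e b) v w (e b) =
      \sum_j \sum_m \sum_b e b 0 j * e b 0 m * F j m.
    transitivity (\sum_b \sum_j \sum_m e b 0 j * e b 0 m * F j m).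
      by apply: eq_bigr => b _; apply: TF.
    by rewrite exchange_big; apply: eq_bigr => j _; rewrite exchange_big.
  rewrite -[RHS]F0 !TF -!big_split; apply: eq_bigr => i _ /=.
  rewrite -!big_split; apply: eq_bigr => m _ /=.
  by rewrite -mulr_suml HE; ring.
have n3 : (3 <= k.+2)%N by apply: leq_trans k_ge3 _; rewrite -addn2 leq_addr.
have idt x y z v w : inner G ell x = 0 -> inner G ell y = 0 -> inner G ell z = 0 ->
  inner G x w * T y z v ell - inner G x v * T y z w ell - inner G y w * T x z v ell
  + inner G y v * T x z w ell + inner G z w * T x y v ell - inner G z v * T x y w ell
  = 0.
  rewrite !ell_a !innerEv => xa ya za.
  exact: (transverse_identity HG Gsym Hsym C12 C34 Ctr ellE Y12 bianchi n3 v w xa ya za).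
have [t2 t1 t1' t0] := null_frame_type_IId k_ge3 T12 T34 Tp Ttr ell_null ell_nu
  (fun b => (e_perp b).1) (fun b => etrans (innerC _ _ Gsym) (e_perp b).2) e_orth idt.
have k2 : (k.+2 - 2 = k)%N by rewrite !subSS subn0.
exists ell, nu, (fun b => e (cast_ord k2 b)); split.
- split => //; by [].
- split=> [b c|b|b c d]; rewrite eval4E; [exact: t2|exact: t1|exact: t1'].
- by move=> b c; rewrite eval4E; apply: t0.
Qed.

End PointwiseType.

Theorem proposition5p2 (R : realType) (n : nat) (n_ge5 : (5 <= n)%N)
    (M : smooth_manifold R n) (g : lorentzian_metric M)
    (alpha : covector_field M)
    (recurrent : conformally_recurrent g alpha)
    (alpha_null : null_covector_field g alpha) :
  forall p : mpoint M, weyl_at_least_type_IId g p.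
Proof.
move=> p c pc.
(* All differentiation takes place in the image of one chart around [p]; what follows is algebra at
   the coordinate point of [p]. *)
pose U : set 'rV[R]_n := [set mcoord c q | q in mdom c].
have openU : open U by apply: mcoord_open.
have lor x : U x -> lorentzian_mx (g c x) by move=> [q qc <-]; apply: met_lorentzian.
have smooth_g : smooth_mx U (g c) by move=> i j; apply: met_smooth.
have g_sym x : U x -> (g c x)^T = g c x by move=> /lor [].
have n0 : (0 < n)%N by apply: leq_trans n_ge5.
have n3 : (3 <= n)%N by apply: leq_trans n_ge5.
have g_unit x : U x -> g c x \in unitmx by move=> /lor; apply: lorentzian_unit.
have Ux : U (mcoord c p) by exists p.
have [_ rec] := recurrent.
have [a_nz a_null] := alpha_null p.
have B i j k l m := weyl_bianchi2 openU smooth_g g_sym g_unit i j k l m Ux.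
move: (weylC openU smooth_g g_sym g_unit) => W12.
have W34 := weyl_skew openU smooth_g g_sym g_unit.
have Wp := weyl_pair openU smooth_g g_sym g_unit.
have Wt := weyl_traceless g_sym g_unit n3.
have [k nk] : exists k, n = k.+2 by exists n.-2; lia.
subst n.
apply: (@pointwise_type_IId R k (g c (mcoord c p)) _
  (fun i => alpha c i (mcoord c p)) (fun i j l => cotton (g c) i j l (mcoord c p))).
- by [].
- exact: lor.
- by move=> *; apply: W12.
- by move=> *; apply: W34.
- by move=> *; apply: Wp.
- by move=> *; apply: Wt.
- by move=> i j l; apply: esym; apply: opprB.
- exact: a_nz.
- exact: a_null.
(* Read backwards, recurrence replaces each product of alpha with the Weyl tensor by a covariant
   derivative, and the cyclic identity [B] applies. *)
- by move=> i j q l m; rewrite -!rec // B.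
Qed.
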